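(* There is an absolute constant $C>0$ such that for every graph $H$ with $t$ vertices, every graph $G$ that does not contain $H$ as an immersion is nonrepetitively $4^{t^4+Ct^2}$-colourable (i.e. has nonrepetitive chromatic number $4^{t^4+O(t^2)}$).
   Context: All graphs are finite and simple (no loops or parallel edges). A $k$-colouring of a graph $G$ is a function assigning one of $k$ colours to each vertex. A path $(v_1,\dots,v_{2s})$ of even order is repetitively coloured by $\psi$ if $\psi(v_i)=\psi(v_{s+i})$ for all $i\in\{1,\dots,s\}$; a colouring is nonrepetitive if no path of even order in $G$ is repetitively coloured. A graph $G$ contains $H$ as an immersion if the vertices of $H$ can be mapped to distinct vertices of $G$ and the edges of $H$ mapped to pairwise edge-disjoint paths of $G$ so that each edge $vw$ of $H$ is mapped to a path whose endpoints are the images of $v$ and $w$. *)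

(* Defs.v *)
From mathcomp Require Import all_boot.

Set Implicit Arguments.
Unset Strict Implicit.
Unset Printing Implicit Defensive.

Record sgraph := SGraph {
  vertex :> finType;
  adj : rel vertex;
  adj_sym : symmetric adj;
  adj_irr : irreflexive adj }.

Definition edges (G : sgraph) : {set {set G}} :=
  [set [set xy.1; xy.2] | xy : G * G & adj xy.1 xy.2].

(* A path has at least one vertex. Nonemptiness matters: the empty sequence has
   even length and would be repetitively coloured by every colouring. *)
Definition is_path (G : sgraph) (p : seq G) : bool :=
  [&& p != [::], uniq p & sorted (@adj G) p].

Definition path_edges (G : sgraph) (p : seq G) : seq {set G} :=
  [seq [set xy.1; xy.2] | xy <- zip p (behead p)].

(* The path may be listed from either end; as a path is nonempty, the default
   value of [head] and [last] plays no role. *)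
Definition path_between (G : sgraph) (u v : G) (p : seq G) : Prop :=
  is_path p /\ ((head u p = u /\ last u p = v) \/
                (head u p = v /\ last u p = u)).

Definition repetitively_coloured (G : sgraph) (K : Type) (psi : G -> K)
    (p : seq G) : Prop :=
  exists2 s : nat, size p = 2 * s &
    forall (x0 : G) (i : nat), i < s ->
      psi (nth x0 p i) = psi (nth x0 p (s + i)).

Definition nonrepetitive (G : sgraph) (K : Type) (psi : G -> K) : Prop :=
  forall p : seq G, is_path p -> ~ repetitively_coloured psi p.

Definition nonrepetitively_colourable (G : sgraph) (k : nat) : Prop :=
  exists psi : G -> 'I_k, nonrepetitive psi.

(* [P] is indexed by unordered pairs, so that each edge of [H] gets one path;
   its values outside [edges H] are irrelevant. *)
Definition contains_immersion (G H : sgraph) : Prop :=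
  exists (f : H -> G) (P : {set H} -> seq G),
    [/\ injective f,
        forall v w : H, adj v w -> path_between (f v) (f w) (P [set v; w]) &
        {in edges H &, forall A B, A != B ->
           [disjoint path_edges (P A) & path_edges (P B)]}].

(* Main.v *)
(** Let [k = t^2]. Uncrossing minimum cuts gives a laminar family [L] of vertex
    sets, each leaving fewer than [k] edges, such that two vertices not separated
    by [L] are [k]-edge-connected. If [t] vertices are pairwise [k]-edge-connected,
    a flow from one of them sending [t] units to each other one yields an immersion
    of every graph on [t] vertices; so every bag of [L] has fewer than [t] vertices.

    Adding a clique on the boundary of each member of [L], and grouping the vertices
    according to the least member of [L] containing their closed neighbourhood, we
    obtain blocks whose earlier neighbours form a clique of size at most [k], and
    which have degree at most [2k] apart from fewer than [t] vertices. Blocks are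
    coloured by Rosenfeld's counting argument. The adhesion [k] is then removed one
    unit at a time: layer the blocks by distance, colour each layer by induction,
    and add a colour of the layer number such that every repetitively coloured walk
    visits the same layers in both halves; the vertices of a repetitive path in its
    first layer would form a repetitive path of that layer. In total
    [t^O(1) * 72^k = 4^O(t^2)] colours are used. *)

Require Import Defs.
From mathcomp Require Import all_boot all_order all_algebra.
From mathcomp Require Import boolp zify ring.

Set Implicit Arguments.
Unset Strict Implicit.
Unset Printing Implicit Defensive.

(** * Graphs of bounded degree *)

(** The halves of a path are separate sequences; equality of their colour sequences already forces
    equal lengths. *)
Definition nonrep_on (V : eqType) (K : Type) (e : rel V) (S : pred V)
    (psi : V -> K) : Prop :=
  forall q r : seq V, q != [::] -> uniq (q ++ r) -> sorted e (q ++ r) ->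
    all S (q ++ r) -> map psi q <> map psi r.

Definition nonrep_colourable (V : eqType) (e : rel V) (S : pred V) (c : nat) : Prop :=
  exists2 psi : V -> nat, forall v, S v -> psi v < c & nonrep_on e S psi.

Lemma nonrep_on_sub (V : eqType) (K : Type) (e e' : rel V) (S S' : pred V)
    (psi : V -> K) :
  {in S &, subrel e e'} -> subpred S S' ->
  nonrep_on e' S' psi -> nonrep_on e S psi.
Proof.
move=> ee' SS' nr q r qn uqr sqr aqr; apply: nr => //.
  by apply: (sub_in_sorted ee' _ sqr).
exact: sub_all aqr.
Qed.

Lemma nonrep_on_eq (V : eqType) (K : Type) (e : rel V) (S : pred V)
    (psi psi' : V -> K) :
  {in S, psi =1 psi'} -> nonrep_on e S psi -> nonrep_on e S psi'.
Proof.
move=> E nr q r qn uqr sqr; rewrite all_cat => /andP[aq ar] eqr.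
apply: (nr q r) => //; first by rewrite all_cat aq.
have E' s : all S s -> map psi s = map psi' s.
  by move=> /allP as_; apply/eq_in_map => x /as_; apply: E.
by rewrite !E'.
Qed.

(** * Enumeration of walks *)

Section Walks.
Variables (V : finType) (e : rel V) (D : nat).
Hypothesis e_sym : symmetric e.
Hypothesis degD : forall v, #|[set w | e v w]| <= D.

Fixpoint walks (v : V) (n : nat) : seq (seq V) :=
  if n is n'.+1 then
    flatten [seq [seq w :: p | p <- walks w n'] | w <- enum [set w | e v w]]
  else [:: [::]].

Lemma mem_walks p v : path e v p -> p \in walks v (size p).
Proof.
elim: p v => [|w p IH] v //= /andP[evw pp]; apply/flatten_mapP.
exists w; first by rewrite mem_enum inE.
by apply/mapP; exists p => //; apply: IH.
Qed.

Lemma size_walks v n : size (walks v n) <= D ^ n.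
Proof.
elim: n v => [|n IH] v //=; rewrite size_flatten /shape -map_comp sumnE big_map.
apply: (@leq_trans (\sum_(w <- enum [set w | e v w]) D ^ n)).
  by apply: leq_sum => w _ /=; rewrite size_map.
rewrite big_const_seq count_predT -cardE iter_addn_0 expnS mulnC.
by rewrite leq_mul2r degD orbT.
Qed.

(** A walk with [s] edges is cut at a visit to [v], after [i] edges, into a reversed walk from [v]
    and a walk from [v]; hence the factor [s.+1] in the count. *)
Definition walks_through v s :=
  flatten [seq [seq rev a ++ v :: b | a <- walks v i, b <- walks v (s - i)]
          | i <- iota 0 s.+1].

Lemma mem_walks_through v p s :
  v \in p -> sorted e p -> size p = s.+1 -> p \in walks_through v s.
Proof.
move=> vp + sp; case/splitPr: p / vp sp => a b.
rewrite size_cat /= addnS => sab sab'.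
have {}sab : size a + size b = s by case: sab.
apply/flatten_mapP; exists (size a); first by rewrite mem_iota; lia.
apply/allpairsP; exists (rev a, b); split => //=.
- rewrite -size_rev; apply: mem_walks.
  have := cat_sorted2 (s := rcons a v) (s' := b).
  rewrite cat_rcons => /(_ _ sab') [].
  rewrite -rev_sorted rev_rcons /=.
  by rewrite (eq_path (e' := e)).
- have -> : s - size a = size b by lia.
  by apply: mem_walks; have /cat_sorted2[] := sab'.
- by rewrite revK.
Qed.

Lemma size_walks_through v s : size (walks_through v s) <= s.+1 * D ^ s.
Proof.
rewrite size_flatten /shape -map_comp sumnE big_map.
apply: (@leq_trans (\sum_(i <- iota 0 s.+1) D ^ s)).
  rewrite big_seq [leqRHS]big_seq; apply: leq_sum => i; rewrite mem_iota => Hi /=.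
  rewrite size_allpairs.
  have -> : D ^ s = D ^ i * D ^ (s - i) by rewrite -expnD; congr (_ ^ _); lia.
  by apply: leq_mul; apply: size_walks.
by rewrite big_const_seq count_predT size_iota iter_addn_0 mulnC.
Qed.
End Walks.

Lemma card_cover_seq (T : finType) (J : eqType) (B : {set T}) (r : seq J)
    (F : J -> {set T}) :
  (forall f, f \in B -> exists2 j, j \in r & f \in F j) ->
  #|B| <= \sum_(j <- r) #|F j|.
Proof.
move=> BF.
elim: r B BF => [|j r IH] B BF.
  rewrite big_nil leqn0 cards_eq0; apply/eqP/setP => f; rewrite inE.
  by apply/negP => /BF[].
rewrite big_cons -(cardsID (F j) B); apply: leq_add.
  by apply: subset_leq_card; apply: subsetIr.
apply: IH => f; rewrite inE => /andP[/negP fj /BF[i]].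
by rewrite inE => /predU1P[->|ir] // fi; exists i.
Qed.

Lemma geometric_sum_bound (K n : nat) (x : nat -> nat) :
  (forall s, x s * 2 ^ s <= K) -> \sum_(s < n) x s <= 2 * K.
Proof.
move=> xK.
(* Multiplied by [2 ^ n], this is the sharper bound [2 * K * (1 - 2^-n)], which carries the
   induction. *)
have H : (\sum_(s < n) x s) * 2 ^ n + 2 * K <= 2 * K * 2 ^ n.
  elim: n => [|n IH]; first by rewrite big_ord0 mul0n muln1.
  rewrite big_ord_recr /= expnS; have := xK n; move: IH.
  by move: (2 ^ n) (bigop _ _ _) (x n) => P S y; lia.
have : 0 < 2 ^ n by rewrite expn_gt0.
by move: H; move: (2 ^ n) (bigop _ _ _) => P S; nia.
Qed.

(** * Rosenfeld's counting argument *)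

Section BoundedDegree.
Variables (V : finType) (e : rel V) (D c : nat).
Hypothesis e_sym : symmetric e.
Hypothesis D_gt0 : 0 < D.
Hypothesis degD : forall v, #|[set w | e v w]| <= D.
Hypothesis cD : 4 * D ^ 2 + 4 * D <= c.+1.

Local Notation col := {ffun V -> 'I_c.+1}.
Local Notation nr S f := (nonrep_on e (mem S) (f : V -> 'I_c.+1)).

(** Colourings of [S] are total functions with value [ord0] off [S], so that each is counted
    once. *)
Definition supported (S : {set V}) (f : col) :=
  [forall x, (x \notin S) ==> (f x == ord0)].

Definition good (S : {set V}) : {set col} :=
  [set f : col | `[< nr S f >] && supported S f].

Lemma supportedP (S : {set V}) (f : col) :
  reflect (forall x, x \notin S -> f x = ord0) (supported S f).
Proof.
apply: (iffP forallP) => H x; first by move=> xS; have /implyP/(_ xS)/eqP := H x.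
by apply/implyP => /H/eqP.
Qed.

Lemma goodP (S : {set V}) (f : col) :
  reflect (nr S f /\ forall x, x \notin S -> f x = ord0) (f \in good S).
Proof.
rewrite inE; apply: (iffP andP) => -[].
  by move=> /asboolP ? /supportedP ?.
by move=> ? ?; split; [apply/asboolP|apply/supportedP].
Qed.

(** Good colourings of [S :\ v] with an arbitrary colour added at [v]; a repetition inside [S] must
    then pass through [v]. *)
Definition extensions (S : {set V}) v : {set col} :=
  [set f : col | `[< nr (S :\ v) f >] && supported S f].

Lemma extensionsP (S : {set V}) v (f : col) :
  reflect (nr (S :\ v) f /\ forall x, x \notin S -> f x = ord0)
          (f \in extensions S v).
Proof.
rewrite inE; apply: (iffP andP) => -[].
  by move=> /asboolP ? /supportedP ?.
by move=> ? ?; split; [apply/asboolP|apply/supportedP].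
Qed.

Lemma card_extensions (S : {set V}) v :
  v \in S -> c.+1 * #|good (S :\ v)| <= #|extensions S v|.
Proof.
move=> vS.
pose F (ag : 'I_c.+1 * col) : col := [ffun x => if x == v then ag.1 else ag.2 x].
have -> : c.+1 * #|good (S :\ v)| = #|setX [set: 'I_c.+1] (good (S :\ v))|.
  by rewrite cardsX cardsT card_ord.
rewrite -(card_in_imset (f := F)).
  apply: subset_leq_card; apply/subsetP => f /imsetP[[a g]].
  rewrite in_setX => /andP[_ /goodP[nrg sg]] ->; apply/extensionsP; split.
    apply: (nonrep_on_eq _ nrg) => x; rewrite !inE => /andP[/negPf xv _].
    by rewrite ffunE xv.
  move=> x xS; rewrite ffunE; case: eqP => [E|_]; first by rewrite E vS in xS.
  by apply: sg; rewrite !inE (negPf xS) andbF.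
move=> [a g] [a' g']; rewrite !in_setX.
move=> /andP[_ /goodP[_ sg]] /andP[_ /goodP[_ sg']] E.
have Ex x : F (a, g) x = F (a', g') x by rewrite E.
congr pair; first by have := Ex v; rewrite !ffunE eqxx.
apply/ffunP => x; have := Ex x; rewrite !ffunE; case: eqP => // -> _.
by rewrite sg ?sg' // !inE eqxx.
Qed.

Definition bad (S : {set V}) v s p : {set col} :=
  [set f : col in extensions S v | [&& uniq p, all (mem S) p, size p == s.*2,
    v \in p & map f (take s p) == map f (drop s p)]].

(** Erasing the colours on [A], the half containing [v], is injective on bad extensions, as the
    erased colours can be read off the other half [B]. The result is good because it avoids [v]. *)
Lemma card_bad_half (S : {set V}) v s p (A B : seq V) :
   (perm_eq (A ++ B) p) -> v \in A ->
  (forall f : col, map f (take s p) = map f (drop s p) -> map f A = map f B) ->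
  bad S v s p != set0 ->
  #|bad S v s p| <= #|good (S :\: [set x in A])|.
Proof.
move=> AB vA fAB /set0Pn[f0]; rewrite !inE.
move=> /andP[_ /and5P[up aS _ vp _]].
have uAB : uniq (A ++ B) by rewrite (perm_uniq AB).
pose F (f : col) : col := [ffun x => if x \in A then ord0 else f x].
rewrite -(card_in_imset (f := F)).
  apply: subset_leq_card; apply/subsetP => _ /imsetP[f fb ->].
  move: fb; rewrite !inE -andbA => /and3P[/asboolP nrf /supportedP sf _].
  apply/andP; split.
    apply/asboolP; apply: (@nonrep_on_eq _ _ _ _ f).
      by move=> x; rewrite !inE => /andP[/negPf xA _]; rewrite ffunE xA.
    apply: (nonrep_on_sub _ _ nrf) => // x /=; rewrite !inE => /andP[xA ->].
    by rewrite andbT; apply: contraNneq xA => ->.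
  apply/supportedP => x; rewrite !inE negb_and negbK ffunE.
  by case: (x \in A) => //=; apply: sf.
move=> f g; rewrite !inE => /andP[_ /and5P[_ _ _ _ /eqP/fAB fE]].
move=> /andP[_ /and5P[_ _ _ _ /eqP/fAB gE]] E.
have Ex x : x \notin A -> f x = g x.
  by move=> xA; have := congr1 (fun h : col => h x) E; rewrite !ffunE (negPf xA).
apply/ffunP => x; case xA: (x \in A); last by apply: Ex; rewrite xA.
have EB : map f B = map g B.
  apply/eq_in_map => y yB; apply: Ex; apply/negP => yA.
  by move: uAB; rewrite cat_uniq => /and3P[_ /hasPn/(_ _ yB)/negP[]].
by have: map f A = map g A; [rewrite fE gE|move/eq_in_map; apply].
Qed.

Lemma good_setD (S W : {set V}) :
  (forall (S' : {set V}) v, #|S'| <= #|S| -> v \in S' ->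
     4 * D ^ 2 * #|good (S' :\ v)| <= #|good S'|) ->
  W \subset S -> (4 * D ^ 2) ^ #|W| * #|good (S :\: W)| <= #|good S|.
Proof.
move=> key; have [n] := ubnP #|W|; elim: n W => // n IH W.
have [->|[w wW]] := set_0Vmem W; first by rewrite cards0 setD0 mul1n.
rewrite ltnS (cardsD1 w) wW => Wn WS.
have wS := subsetP WS _ wW.
apply: leq_trans (IH (W :\ w) _ _); first last.
- by apply: subset_trans WS; apply: subD1set.
- exact: Wn.
rewrite expnD expn1 mulnAC [leqRHS]mulnC leq_mul2r; apply/orP; right.
have -> : S :\: W = (S :\: (W :\ w)) :\ w.
  apply/setP => x; rewrite !inE; case: eqVneq => //= ->; by rewrite wW.
apply: key; first by apply: subset_leq_card; apply: subsetDl.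
by rewrite !inE eqxx.
Qed.

(** Besides [v], the erased half has [s] vertices, and restoring each of them multiplies the number
    of good colourings by at least [4 * D ^ 2]. *)
Lemma card_bad (S : {set V}) v s p :
  (forall (S' : {set V}) u, #|S'| < #|S| -> u \in S' ->
     4 * D ^ 2 * #|good (S' :\ u)| <= #|good S'|) ->
  v \in S -> (4 * D ^ 2) ^ s * #|bad S v s.+1 p| <= #|good (S :\ v)|.
Proof.
move=> key vS.
have [->|bn0] := eqVneq (bad S v s.+1 p) set0; first by rewrite cards0 muln0.
have /set0Pn[f] := bn0; rewrite inE => /andP[_ /and5P[up aS /eqP sp vp _]].
suff H (A B : seq V) : perm_eq (A ++ B) p -> v \in A -> size A = s.+1 ->
    (forall g : col, map g (take s.+1 p) = map g (drop s.+1 p) -> map g A = map g B) ->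
    (4 * D ^ 2) ^ s * #|bad S v s.+1 p| <= #|good (S :\ v)|.
  have: v \in take s.+1 p ++ drop s.+1 p by rewrite cat_take_drop.
  rewrite mem_cat => /orP[vt|vd].
    apply: (H (take s.+1 p) (drop s.+1 p)) => //; first by rewrite cat_take_drop.
    by rewrite size_takel // sp; lia.
  apply: (H (drop s.+1 p) (take s.+1 p)) => //; last by rewrite size_drop sp; lia.
  by rewrite perm_catC cat_take_drop.
move=> AB vA sA fAB.
have uA : uniq A by move: up; rewrite -(perm_uniq AB) cat_uniq => /andP[].
have cA : #|[set x in A]| = s.+1.
  by rewrite cardsE; move/card_uniqP: uA => ->.
have AS : [set x in A] \subset S.
  apply/subsetP => x; rewrite inE => xA; apply: (allP aS).
  by rewrite -(perm_mem AB) mem_cat xA.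
have cAv : #|[set x in A] :\ v| = s.
  by move: cA; rewrite (cardsD1 v) inE vA => -[].
have E : S :\: [set x in A] = (S :\ v) :\: ([set x in A] :\ v).
  by apply/setP => x; rewrite !inE; case: eqVneq => //= ->; rewrite vA.
have := card_bad_half AB vA fAB bn0; rewrite E => Hb.
apply: (leq_trans (n := (4 * D ^ 2) ^ s * #|good (S :\ v :\: ([set x in A] :\ v))|)).
  by rewrite leq_mul2l Hb orbT.
rewrite -{1}cAv; apply: good_setD; last by apply: setSD.
move=> S' u hS'; apply: key; apply: leq_ltn_trans hS' _.
by rewrite [ltnRHS](cardsD1 v) vS.
Qed.

(** At most [s.*2.+2 * D ^ s.*2.+1] walks on [s.*2.+2] vertices pass through [v], and [card_bad]
    applies to each. One factor [2 ^ s] of the resulting decay absorbs [s.+1]. *)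
Lemma card_bad_level (S : {set V}) v s :
  (forall (S' : {set V}) u, #|S'| < #|S| -> u \in S' ->
     4 * D ^ 2 * #|good (S' :\ u)| <= #|good S'|) ->
  v \in S ->
  (\sum_(p <- walks_through e v s.*2.+1) #|bad S v s.+1 p|) * 2 ^ s
    <= 2 * D * #|good (S :\ v)|.
Proof.
move=> key vS; set x := \sum_(p <- _) _; set M := #|_|.
have D2s : 0 < D ^ s.*2 by rewrite expn_gt0 D_gt0.
have H : (4 * D ^ 2) ^ s * x <= s.*2.+2 * D ^ s.*2.+1 * M.
  rewrite big_distrr /=.
  apply: (@leq_trans (\sum_(p <- walks_through e v s.*2.+1) M)).
    by apply: leq_sum => p _; apply: card_bad.
  rewrite big_const_seq count_predT iter_addn_0 mulnC leq_mul2r.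
  by rewrite size_walks_through ?orbT.
have s2 : s.+1 <= 2 ^ s by rewrite ltn_expl.
have E4 : (4 * D ^ 2) ^ s = 2 ^ s * 2 ^ s * D ^ s.*2.
  by rewrite expnMn -expnM mul2n -expnMn.
move: H; rewrite E4 expnS.
have P2 : 0 < 2 ^ s by rewrite expn_gt0.
have -> : s.*2.+2 = 2 * s.+1 by lia.
move=> H; rewrite -(leq_pmul2l (m := 2 ^ s * D ^ s.*2)); last by rewrite muln_gt0 P2.
apply: (@leq_trans (2 * s.+1 * (D * D ^ s.*2) * M)).
  by apply: leq_trans H; rewrite leq_eqVlt; apply/orP; left; apply/eqP; ring.
have -> : 2 ^ s * D ^ s.*2 * (2 * D * M) = 2 * 2 ^ s * (D * D ^ s.*2) * M by ring.
by rewrite !leq_mul2r leq_mul2l s2 !orbT.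
Qed.

(* Rosenfeld's counting argument: a repetitive path through [v] is recovered from
   the colouring of the half not containing [v], so by induction the bad
   extensions are outnumbered. *)
Lemma card_good_step (S : {set V}) v :
  v \in S -> 4 * D ^ 2 * #|good (S :\ v)| <= #|good S|.
Proof.
have [n] := ubnP #|S|; elim: n S v => // n IH S v Sn vS.
have key (S' : {set V}) u : #|S'| < #|S| -> u \in S' ->
     4 * D ^ 2 * #|good (S' :\ u)| <= #|good S'|.
  by move=> S'S; apply: IH; apply: leq_trans S'S _; rewrite -ltnS.
set M := #|good (S :\ v)|.
(* Summing the geometric decay over all half-lengths bounds the failures by [4 * D * M]. *)
have badM : #|extensions S v :\: good S| <= 2 * (2 * D * M).
  apply: leq_trans (geometric_sum_bound #|V| (fun s => card_bad_level s key vS)).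
  rewrite -(big_mkord predT (fun s =>
    \sum_(p <- walks_through e v s.*2.+1) #|bad S v s.+1 p|)).
  pose r := [seq (s, p) | s <- iota 0 #|V|, p <- walks_through e v s.*2.+1].
  pose F (j : nat * seq V) := bad S v j.1.+1 j.2.
  apply: (@leq_trans (\sum_(j <- r) #|F j|)); last first.
    by rewrite big_allpairs_dep /index_iota subn0.
  apply: card_cover_seq => f; rewrite in_setD => /andP[fng fe].
  have /extensionsP[nrf sf] := fe.
  have nnr : ~ nr S f by move=> nrS; move/negP: fng; apply; apply/goodP.
  apply: contrapT => nex; apply: nnr => q r' qn uqr sqr aqr fqr.
  have sz : size r' = size q by rewrite -(size_map f) -fqr size_map.
  case vqr: (v \in q ++ r'); last first.
    apply: (nrf q r') => //; apply/allP => x xqr.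
    have xS : x \in S := allP aqr _ xqr.
    by rewrite /= !inE xS andbT; apply: contraFneq vqr => <-.
  case: q => // a q in qn uqr sqr aqr fqr sz vqr nex *.
  apply: nex; exists (size q, (a :: q) ++ r').
    apply/allpairsPdep; exists (size q), ((a :: q) ++ r'); split => //.
      rewrite mem_iota add0n /=.
      have := max_card (mem ((a :: q) ++ r')).
      by move/card_uniqP: uqr => ->; rewrite size_cat /=; lia.
    by apply: mem_walks_through; rewrite // size_cat sz /=; lia.
  rewrite inE fe uqr aqr vqr take_size_cat // drop_size_cat //.
  by rewrite fqr eqxx size_cat sz addnn eqxx.
(* Of at least [c.+1 * M] extensions, removing the failures leaves [4 * D ^ 2 * M] by [cD]. *)
have := card_extensions vS; rewrite -/M -(cardsID (good S) (extensions S v)).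
have : #|extensions S v :&: good S| <= #|good S|.
  by apply: subset_leq_card; apply: subsetIr.
by move: badM cD; nia.
Qed.

Lemma bounded_degree_nonrep_colourable : nonrep_colourable e predT c.+1.
Proof.
have : 0 < #|good setT|.
  apply: (leq_trans _ (good_setD (W := setT) _ _)) => //; last first.
    by move=> S' v _; apply: card_good_step.
  rewrite muln_gt0 expn_gt0 muln_gt0 expn_gt0 D_gt0 /=.
  apply/card_gt0P; exists [ffun => ord0]; apply/goodP; split => [|x _].
    by case=> // x q r _ _ _ /andP[]; rewrite /= in_setD in_setT.
  by rewrite ffunE.
move=> /card_gt0P[f /goodP[nrf _]]; exists (fun v => f v : nat) => [v _|] //.
move=> q r qn uqr sqr _ E; apply: (nrf q r) => //.
  by apply/allP => x; rewrite inE.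
apply: (inj_map val_inj); rewrite -!map_comp; exact: E.
Qed.
End BoundedDegree.

(** * Walks on the integers *)

(** Factors of the word are subpaths of the path on [0, ..., n], whose degrees are at most 2; this
    gives [4 * 2 ^ 2 + 4 * 2 = 24] letters. *)
Lemma square_free_word (n : nat) : exists2 w : nat -> nat, forall i, w i < 24 &
  forall a L, 0 < L -> a + L.*2 <= n ->
    ~ (forall j, j < L -> w (a + j) = w (a + L + j)).
Proof.
pose e := [rel i j : 'I_n.+1 | (i.+1 == j :> nat) || (j.+1 == i :> nat)].
have e_sym : symmetric e by move=> i j; rewrite /= orbC.
have [//|v|//|w w24 nrw] := @bounded_degree_nonrep_colourable _ e 2 23 e_sym.
- apply: leq_trans (_ : #|[set inord v.+1; inord v.-1] : {set 'I_n.+1}| <= _); last first.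
    by rewrite cards2; case: (_ != _).
  apply: subset_leq_card; apply/subsetP => j; rewrite !inE.
  move=> /orP[/eqP vj|/eqP jv].
    by apply/orP; left; rewrite vj inord_val.
  by apply/orP; right; rewrite -jv inord_val.
exists (fun i => w (inord i)) => [i|a L L0 aL H]; first exact: w24.
pose s b m : seq 'I_n.+1 := [seq inord i | i <- iota b m].
have catE : s a L ++ s (a + L) L = s a L.*2.
  by rewrite -map_cat -iotaD addnn.
have sortedE : forall m b, b + m <= n.+1 -> sorted e (s b m).
  elim=> [|[|m] IH] b bm //=; have := IH b.+1; rewrite /= => ->; last by lia.
  by rewrite !inordK ?eqxx //; lia.
apply: (nrw (s a L) (s (a + L) L)); rewrite ?catE.
- by case: L L0 {aL H catE}.
- rewrite map_inj_in_uniq ?iota_uniq // => i j; rewrite !mem_iota => Hi Hj.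
  by move/(congr1 val); rewrite /= !inordK //; lia.
- by apply: sortedE; lia.
- by apply/allP.
apply: (@eq_from_nth _ 0); rewrite !size_map !size_iota // => i iL.
by rewrite -!map_comp !(nth_map 0) ?size_iota // !nth_iota //= H.
Qed.

Lemma discrete_ivt (f : nat -> nat) (m v : nat) :
  (forall i, i < m -> f i.+1 <= (f i).+1) -> f 0 <= v <= f m ->
  exists2 i, i <= m & f i = v.
Proof.
elim: m => [|m IH] fS /andP[f0 fm]; first by exists 0 => //; lia.
have [vm|mv] := leqP v (f m).
  have [i im fi] : exists2 i, i <= m & f i = v.
    by apply: IH => [i im|]; [apply: fS; lia|rewrite f0].
  by exists i => //; lia.
by exists m.+1 => //; have := fS m (leqnn _); lia.
Qed.

(* The residue mod 3 in the colour reveals every step of the walk, so the two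
   halves of a repetition are translates of each other; a nonzero translation
   would produce a square in [w]. *)
Lemma walk_colouring (n : nat) : exists2 phi : nat -> nat, forall i, phi i < 72 &
  forall q r : seq nat,
    sorted (fun x y => (x <= y.+1) && (y <= x.+1)) (q ++ r) ->
    all (fun x => x <= n) (q ++ r) -> map phi q = map phi r -> q = r.
Proof.
(* The squares found below occupy positions up to [n], so their exclusive end is at most [n.+1]. *)
have [w w24 wsf] := square_free_word n.+1.
pose phi i := i %% 3 + 3 * w i.
exists phi => [i|q r sqr aqr Eqr].
  by rewrite /phi; have := w24 i; have := ltn_pmod i (isT : 0 < 3); lia.
have sz : size r = size q by rewrite -(size_map phi) -Eqr size_map.
case: (posnP (size q)) => [/size0nil q0|q_gt0].
  by move: sz; rewrite q0 => /size0nil.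
pose x i := nth 0 (q ++ r) i; set s := size q in sz q_gt0 *.
have xq i : i < s -> nth 0 q i = x i by move=> si; rewrite /x nth_cat -/s si.
have xr i : nth 0 r i = x (s + i).
  by rewrite /x nth_cat -/s ltnNge leq_addr /= addKn.
have step i : i.+1 < s.*2 -> (x i <= (x i.+1).+1) && (x i.+1 <= (x i).+1).
  move=> si; apply: (sortedP 0 sqr); by rewrite size_cat sz addnn.
have bnd i : i < s.*2 -> x i <= n.
  by move=> si; apply: (allP aqr); apply: mem_nth; rewrite size_cat sz addnn.
have phiE i : i < s -> phi (x i) = phi (x (s + i)).
  move=> si; rewrite -xq // -xr -!(nth_map 0 (phi 0)) ?sz //; by rewrite Eqr.
have mod3 i : i < s -> x i = x (s + i) %[mod 3].
  by move=> /phiE; rewrite /phi; lia.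
have wE i : i < s -> w (x i) = w (x (s + i)).
  by move=> /phiE; rewrite /phi; lia.
(* Subtraction-free form of [x (s + i) - x i = x s - x 0]: corresponding steps lie in [{-1, 0, 1}]
   and agree modulo 3. *)
have transl i : i < s -> x (s + i) + x 0 = x s + x i.
  elim: i => [|i IH] si; first by rewrite addn0.
  have := IH (ltnW si); have := mod3 _ si; have := mod3 _ (ltnW si).
  have := step i; have := step (s + i); rewrite addnS; lia.
have xs0 : x s = x 0.
  apply/eqP; rewrite eqn_leq; apply/andP; split; rewrite leqNgt; apply/negP => lt.
  (* For an upward shift, the first half takes every value from [x 0] up to but excluding [x s],
     which gives a square starting at [x 0]. *)
  - have ivt v : x 0 <= v < x s -> exists2 i, i < s & x i = v.
      move=> Hv; have [i||i si <-] := @discrete_ivt x s.-1 v.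
      + by move=> si; have := step i; lia.
      + by have := step s.-1; rewrite prednK //; lia.
      by exists i => //; lia.
    apply: (wsf (x 0) (x s - x 0)); first by lia.
      have [|i si xi] := ivt (x s).-1; first by lia.
      by have := transl _ si; have := bnd (s + i); lia.
    move=> j jL; have [|i si xi] := ivt (x 0 + j); first by lia.
    by rewrite -xi wE //; congr w; have := transl _ si; lia.
  (* For a downward shift, reading the first half backwards shows that it takes every value above
     [x s] up to [x 0]. These values are the second half of the square, and their translates,
     starting at [x (s + i0)], are the first. *)
  - have ivt v : x s < v <= x 0 -> exists2 i, i < s & x i = v.
      move=> Hv; have [i||i si <-] := @discrete_ivt (fun i => x (s.-1 - i)) s.-1 v.
      + move=> si; have := step (s.-1 - i.+1).
        by rewrite (_ : (s.-1 - i.+1).+1 = s.-1 - i); lia.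
      + by rewrite subn0 subnn; have := step s.-1; rewrite prednK //; lia.
      by exists (s.-1 - i) => //; lia.
    have [|i0 si0 xi0] := ivt (x s).+1; first by lia.
    have T0 := transl _ si0.
    apply: (wsf (x (s + i0)) (x 0 - x s)); first by lia.
      by have := bnd 0; lia.
    move=> j jL; have [|i si xi] := ivt ((x s).+1 + j); first by lia.
    have T1 := transl _ si.
    have -> : x (s + i0) + (x 0 - x s) + j = x i by lia.
    by rewrite wE //; congr w; lia.
apply: (@eq_from_nth _ 0) => [|i si]; first by rewrite sz.
by rewrite xq // xr; have := transl _ si; lia.
Qed.

(** * Clique blocks *)

Section Blocks.
Variables (V : finType) (h : V -> nat).

Definition backnbrs (e : rel V) (z : nat) : {set V} :=
  [set u | (h u < z) && [exists v, (h v == z) && e u v]].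

(** A reversed perfect elimination order with blocks, the fibres of [h], in place of vertices; edges
    inside a block are unrestricted. *)
Definition clique_blocks (e : rel V) (k : nat) : Prop :=
  forall z, #|backnbrs e z| <= k /\ {in backnbrs e z &, forall u v, u != v -> e u v}.

(** * Layers by distance *)

Section Layering.
Variable e : rel V.
Variable k : nat.
Hypothesis e_sym : symmetric e.
Hypothesis cb : clique_blocks e k.

Local Notation A := (backnbrs e).

Lemma mem_backnbrs u v : e u v -> h u < h v -> u \in A (h v).
Proof. by move=> euv huv; rewrite inE huv; apply/existsP; exists v; rewrite eqxx. Qed.

Lemma backnbrs_lt u z : u \in A z -> h u < z.
Proof. by rewrite inE => /andP[]. Qed.

(** Least number of steps through earlier neighbours to a block that has none. The minimiser [u]
    lies in the previous layer. *)
Definition depth_spec (d : nat -> nat) z :=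
  (A z = set0 /\ d z = 0) \/
  (exists2 u, u \in A z &
     d z = (d (h u)).+1 /\ forall u', u' \in A z -> d (h u) <= d (h u')).

Lemma depth_exists n : exists d, forall z, z < n -> depth_spec d z.
Proof.
elim: n => [|n [d dP]]; first by exists (fun=> 0).
pose a := if [pick u in A n] is Some u0
  then (d (h [arg min_(u < u0 in A n) d (h u)])).+1 else 0.
exists (fun z => if z == n then a else d z) => z; rewrite ltnS leq_eqVlt.
have hE u z' : u \in A z' -> z' <= n -> (h u == n) = false.
  by move/backnbrs_lt; lia.
case: eqVneq => /= [-> _|zn zn'].
  rewrite /depth_spec /a eqxx; case: pickP => [u0 u0A|A0]; last first.
    by left; split=> //; apply/setP => u; rewrite [RHS]inE; apply: A0.
  right; case: arg_minnP => // u uA umin; exists u => //.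
  rewrite (hE u n) //; split => // u' u'A; rewrite (hE u' n) //; exact: umin.
have := dP z zn'; rewrite /depth_spec (negPf zn) => -[|[u uA [du umin]]]; first by left.
right; exists u => //; rewrite (hE u z) ?(ltnW zn') //; split => // u' u'A.
by rewrite (hE u' z) ?(ltnW zn') //; apply: umin.
Qed.

Variable d : nat -> nat.
Hypothesis dP : forall z, (exists v, h v = z) -> depth_spec d z.
Local Notation dv v := (d (h v)).

Lemma depth_le v : dv v <= h v.
Proof.
have [n] := ubnP (h v); elim: n v => // n IH v vn.
have [] := dP (ex_intro _ v erefl); first by case=> _ ->.
by case=> u /backnbrs_lt uv [-> _]; have := IH u; lia.
Qed.

(** An earlier neighbour [u] and the minimiser [u0] are equal or adjacent, lying in a clique; by
    induction their depths differ by at most one. *)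
Lemma depth_step u v : u \in A (h v) -> dv u <= dv v <= (dv u).+1.
Proof.
have [n] := ubnP (h v); elim: n u v => // n IH u v vn uA.
have [[A0]|[u0 u0A [-> umin]]] := dP (ex_intro _ v erefl).
  by rewrite A0 inE in uA.
rewrite ltnS umin // andbT.
have [->|uu0] := eqVneq u u0; first by [].
have euu0 := (cb (h v)).2 _ _ uA u0A uu0.
have hu := backnbrs_lt uA; have hu0 := backnbrs_lt u0A.
have [lt|gt|->] := ltngtP (h u) (h u0); last by [].
  by have := IH u u0 _ (mem_backnbrs euu0 lt); lia.
by rewrite e_sym in euu0; have := IH u0 u _ (mem_backnbrs euu0 gt); lia.
Qed.

(** A bag is a block with its earlier neighbours. [bag_adj] makes every bag a reflexive clique, also
    joining vertices of a block that [e] leaves non-adjacent. *)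
Definition in_bag z x := (h x == z) || (x \in A z).
Definition bag_adj x y := in_bag (h y) x || in_bag (h x) y.

Lemma bag_adj_sub : subrel e bag_adj.
Proof.
move=> x y exy; rewrite /bag_adj /in_bag; have [lt|gt|->] := ltngtP (h x) (h y).
- by rewrite mem_backnbrs.
- by rewrite e_sym in exy; rewrite (mem_backnbrs exy gt) ?orbT.
by [].
Qed.

Lemma bag_adj_depth x y : bag_adj x y -> (dv x <= (dv y).+1) && (dv y <= (dv x).+1).
Proof.
by move=> /orP[]/orP[/eqP->|/depth_step]; lia.
Qed.

Lemma in_bag_adj z x y : in_bag z x -> in_bag z y -> bag_adj x y.
Proof.
rewrite /bag_adj => /orP[/eqP->|xA]; first by move=> ->; rewrite orbT.
move=> /orP[/eqP->|yA]; first by rewrite /in_bag xA orbT.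
have [->|xy] := eqVneq x y; first by rewrite /in_bag eqxx.
exact: bag_adj_sub ((cb z).2 _ _ xA yA xy).
Qed.

Lemma bag_adj_shallow x y : bag_adj x y -> dv x < dv y -> x \in A (h y).
Proof.
by move=> /orP[/orP[/eqP->|//]|/orP[/eqP->|/depth_step]]; lia.
Qed.

(* Deleting a deeper vertex of the last block from a walk keeps it a walk,
   since bags are cliques for [bag_adj]. *)
Lemma excursion_adj u s w : s != [::] -> path bag_adj u (rcons s w) ->
  all (fun x => dv u < dv x) s -> dv w = dv u -> u = w \/ e u w.
Proof.
have [n] := ubnP (size s); elim: n s => // n IH s sn s0 ps als dw.
(* For [x] in the latest block visited, both neighbours on the walk lie in the bag of that block. *)
have [x xs xmax] : exists2 x, x \in s & forall y, y \in s -> h y <= h x.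
  case: s s0 {sn ps als IH} => // a s _.
  have [x xs xmax] := arg_maxnP h (mem_head a s : (a \in [in a :: s])).
  by exists x.
have bag_x y : (y \in s) || (dv y == dv u) -> bag_adj y x -> in_bag (h x) y.
  move=> yP yx; have dx := allP als _ xs.
  case/orP: yP => [ys|/eqP dy]; last first.
    by rewrite /in_bag (bag_adj_shallow yx) ?orbT // dy.
  case/orP: yx => // /orP[/eqP E|/backnbrs_lt]; first by rewrite /in_bag E eqxx.
  by have := xmax y ys; lia.
case/splitPr: s / xs sn s0 ps als bag_x {xmax} => s1 s2 sn _ + als bag_x.
rewrite rcons_cat cat_path /= => /and3P[ps1 lx ps2].
have bl : in_bag (h x) (last u s1).
  apply: bag_x lx; rewrite mem_cat; have := mem_last u s1; rewrite inE.
  by case/predU1P=> [->|->]; rewrite ?eqxx ?orbT.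
have bh : in_bag (h x) (head w s2).
  apply: bag_x.
    by case: (s2) => [|y s3] /=; rewrite ?dw ?eqxx ?orbT // mem_cat !inE eqxx !orbT.
  by case: (s2) ps2 => [|y s3] /= /andP[]; rewrite /bag_adj orbC.
have ps' : path bag_adj u (rcons (s1 ++ s2) w).
  rewrite rcons_cat cat_path ps1 /=; have := in_bag_adj bl bh.
  by case: (s2) ps2 => [|y s3] /= /andP[_ p3] ->.
have als' : all (fun x => dv u < dv x) (s1 ++ s2).
  by move: als; rewrite !all_cat /= => /and3P[-> _ ->].
have [s12|s12] := eqVneq (s1 ++ s2) [::]; last first.
  by apply: IH s12 ps' als' dw; move: sn; rewrite !size_cat /=; lia.
(* The excursion is the single vertex [x]: [u] and [w] are shallower, hence earlier neighbours of
   its block, and those form a clique of [e] itself. *)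
case: s1 s12 als bl lx {ps1 ps' als' sn bag_x} => //= s2E; rewrite s2E /= in ps2 bh *.
move=> /andP[dx _] _ ux; case/andP: ps2 => xw _.
have [->|uw] := eqVneq u w; [by left|right].
apply: (cb (h x)).2 uw; first exact: bag_adj_shallow.
by apply: bag_adj_shallow; [rewrite /bag_adj orbC|rewrite dw].
Qed.

(** [u] is the last vertex met in the layer, and [t] is the excursion into deeper layers made since
    then. *)
Lemma path_filter_layer s t u : path bag_adj u t -> all (fun x => dv u < dv x) t ->
  path e (last u t) s -> all (fun x => dv u <= dv x) s -> u \notin s -> uniq s ->
  path e u [seq x <- s | dv x == dv u].
Proof.
elim: s t u => [//|x s IH] t u put alt /= /andP[lx pxs] /andP[dx als].
rewrite inE negb_or => /andP[ux us] /andP[xs unis].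
case: ifPn => [/eqP E|nE]; last first.
  apply: (IH (rcons t x)); rewrite ?last_rcons //.
    by rewrite rcons_path put bag_adj_sub.
  by rewrite all_rcons alt andbT; lia.
rewrite /= -E; apply/andP; split; last by apply: (IH [::]); rewrite //= E.
have [t0|tn0] := eqVneq t [::]; first by move: lx; rewrite t0.
have [] // := @excursion_adj u t x tn0 _ alt E.
  by rewrite rcons_path put bag_adj_sub.
by move=> uxE; rewrite uxE eqxx in ux.
Qed.

Lemma sorted_filter_layer m s : sorted e s -> uniq s -> all (fun x => m <= dv x) s ->
  sorted e [seq x <- s | dv x == m].
Proof.
elim: s => [//|x s IH] /= pxs /andP[xs us] /andP[mx als].
case: ifPn => [/eqP E|_]; last by apply: IH => //; apply: path_sorted pxs.
by rewrite /= -E; apply: (@path_filter_layer s [::]); rewrite //= E.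
Qed.

Lemma layers_nonrep_colourable c : (forall m, nonrep_colourable e (fun v => dv v == m) c) ->
  nonrep_colourable e predT (c * 72).
Proof.
move=> H.
have /choice[psi psiP] : forall m, exists psi : V -> nat,
    (forall v, dv v == m -> psi v < c) /\ nonrep_on e (fun v => dv v == m) psi.
  by move=> m; have [psi] := H m; exists psi.
pose n := \max_v h v.
have [phi phi72 phiP] := walk_colouring n.
pose col v := phi (dv v) * c + psi (dv v) v.
have psi_lt v : psi (dv v) v < c by apply: (psiP _).1.
exists col => [v _|q r qn uqr sqr _ E].
  by rewrite /col; have := psi_lt v; have := phi72 (dv v); nia.
have colE u v : col u = col v -> phi (dv u) = phi (dv v) /\ psi (dv u) u = psi (dv v) v.
  rewrite /col => Euv; have c0 := leq_ltn_trans (leq0n _) (psi_lt u).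
  split.
    by have := congr1 (divn^~ c) Euv; rewrite !divnMDl // !divn_small // !addn0.
  by have := congr1 (modn^~ c) Euv; rewrite !modnMDl !modn_small.
have map_col (T : Type) (f : V -> T) : (forall u v, col u = col v -> f u = f v) ->
    map f q = map f r.
  move=> fP; elim: (q) (r) E => [|a q' IH] [|b r'] //= [/fP -> /IH ->] //.
have Ed : map (fun v => dv v) q = map (fun v => dv v) r.
  (* Adjacent vertices have depths differing by at most one, so the depths along the path form a
     walk on the integers. *)
  apply: phiP.
  - rewrite -map_cat sorted_map; apply: sub_sorted sqr => x y /bag_adj_sub.
    exact: bag_adj_depth.
  - rewrite -map_cat all_map; apply/allP => v _ /=.
    by apply: leq_trans (depth_le v) _; apply: leq_bigmax.
  by rewrite -!map_comp; apply: map_col => u v /colE[].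
(* Depth and layer colour are paired so that selecting a layer keeps the same positions in both
   halves. *)
have Eg : map (fun v => (dv v, psi (dv v) v)) q = map (fun v => (dv v, psi (dv v) v)) r.
  have Ep : map (fun v => psi (dv v) v) q = map (fun v => psi (dv v) v) r.
    by apply: map_col => u v /colE[].
  elim: (q) (r) Ed Ep => [|a q' IH] [|b r'] //= [-> Ed] [-> Ep].
  by rewrite (IH r').
have [x0 x0q] : exists x, x \in q by case: (q) qn => // x q' _; exists x; apply: mem_head.
(* Every excursion from the least layer goes deeper, as [sorted_filter_layer] requires. *)
have [x xq xmin] := arg_minnP (fun v => dv v) (x0q : (x0 \in [in q])).
pose m := dv x; pose F := [pred v | dv v == m].
have minq v : v \in q -> m <= dv v by apply: xmin.
have minr v : v \in r -> m <= dv v.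
  move=> vr; have: dv v \in map (fun v => dv v) r by apply: map_f.
  by rewrite -Ed => /mapP[y yq ->]; apply: minq.
apply: ((psiP m).2 (filter F q) (filter F r)); rewrite -?filter_cat.
- by rewrite -has_filter; apply/hasP; exists x => //=.
- exact: filter_uniq.
- apply: sorted_filter_layer => //; apply/allP => v; rewrite mem_cat.
  by case/orP => [/minq|/minr].
- exact: filter_all.
have := congr1 (fun s => map snd (filter (fun ab => ab.1 == m) s)) Eg.
rewrite !filter_map -!map_comp.
have psiE s : [seq (snd \o (fun v => (dv v, psi (dv v) v))) i | i <- s & F i]
            = [seq psi m i | i <- s & F i].
  by apply/eq_in_map => v; rewrite mem_filter => /andP[/eqP<- _].
by move=> Hs; rewrite -!psiE; exact: Hs.
Qed.
End Layering.

(** Inside one layer a block loses at least the minimiser from its earlier neighbours, so [k] drops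
    by one at the cost of a factor 72. For [k = 0] no edge joins two blocks, and a path stays in one
    block. *)
Lemma clique_blocks_nonrep_colourable (e : rel V) (k c : nat) :
  symmetric e -> clique_blocks e k -> (forall z, nonrep_colourable e (fun v => h v == z) c) ->
  nonrep_colourable e predT (c * 72 ^ k).
Proof.
elim: k e => [|k IH] e e_sym cb colb.
  have /choice[psi psiP] : forall z, exists psi : V -> nat,
      (forall v, h v == z -> psi v < c) /\ nonrep_on e (fun v => h v == z) psi.
    by move=> m; have [psi] := colb m; exists psi.
  rewrite muln1; exists (fun v => psi (h v) v) => [v _|q r qn uqr sqr _ E].
    exact: (psiP _).1.
  have eh u v : e u v -> h v == h u.
    have A0 z : backnbrs e z = set0 by apply: cards0_eq; have := (cb z).1; lia.
    move=> euv; have [lt|gt|//] := ltngtP.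
      by rewrite e_sym in euv; have := mem_backnbrs euv lt; rewrite A0 inE.
    by have := mem_backnbrs euv gt; rewrite A0 inE.
  have [x [s qrE]] : exists x s, q ++ r = x :: s.
    by case: (q) qn => // x q' _; exists x, (q' ++ r).
  have hall v : v \in q ++ r -> h v == h x.
    rewrite qrE in sqr *; rewrite inE => /predU1P[->|] //.
    elim: s x sqr {qrE} => //= y s IHs x /andP[/eh/eqP<- /IHs H].
    by rewrite inE => /predU1P[->|] //.
  apply: ((psiP (h x)).2 q r) => //; first by apply/allP.
  have Es s' : {subset s' <= q ++ r} -> map (psi (h x)) s' = map (fun v => psi (h v) v) s'.
    by move=> sub; apply/eq_in_map => v /sub/hall/eqP->.
  by rewrite !Es // => v; rewrite mem_cat => ->; rewrite ?orbT.
have [d dP'] := depth_exists e (\max_v h v).+1.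
have dP z : (exists v, h v = z) -> depth_spec e d z.
  by case=> v <-; apply: dP'; rewrite ltnS; apply: leq_bigmax.
rewrite expnS mulnCA mulnC; apply: (layers_nonrep_colourable e_sym cb dP) => m.
pose em := [rel u v | [&& e u v, d (h u) == m & d (h v) == m]].
have em_sym : symmetric em by move=> u v /=; rewrite e_sym [(_ == m) && _]andbC.
have sub z : backnbrs em z \subset [set u in backnbrs e z | d (h u) == m].
  apply/subsetP => u; rewrite !inE => /andP[-> /existsP[v /and4P[hv euv -> _]]].
  by rewrite andbT; apply/existsP; exists v; rewrite hv.
have [|z|psi psi_lt psi_nr] := IH em em_sym.
- move=> z; split; last first.
    move=> u v /(subsetP (sub z)); rewrite inE => /andP[uA du].
    move=> /(subsetP (sub z)); rewrite inE => /andP[vA dv uv] /=.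
    by rewrite du dv ((cb z).2 _ _ uA vA uv).
  have [->|[w wz]] := set_0Vmem (backnbrs em z); first by rewrite cards0.
  move: (wz); rewrite inE => /andP[_ /existsP[v /and4P[/eqP hv _ _ dvm]]].
  have wA : w \in backnbrs e z by have := subsetP (sub z) _ wz; rewrite inE => /andP[].
  have [[A0 _]|[u uA [du _]]] := dP z (ex_intro _ v hv).
    by rewrite A0 inE in wA.
  have := (cb z).1; rewrite (cardsD1 u) uA ltnS; apply: leq_trans.
  apply: subset_leq_card; apply/subsetP => x /(subsetP (sub z)).
  rewrite inE => /andP[xA /eqP dx]; rewrite in_setD1 xA andbT.
  by apply: contraTneq dvm => xu; rewrite hv du -xu dx; lia.
- have [psi psi_lt psi_nr] := colb z; exists psi => //.
  by apply: nonrep_on_sub psi_nr => // u v _ _ /andP[].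
exists psi => [v _|]; first exact: psi_lt.
by apply: nonrep_on_sub psi_nr => // u v du dv /= -> /=; apply/andP.
Qed.
End Blocks.

(** * Minimum cuts *)

Section Cuts.
Variables (V : finType) (e : rel V).
Hypothesis e_sym : symmetric e.

Definition cut (S : {set V}) : {set V * V} :=
  [set uv | [&& uv.1 \in S, uv.2 \notin S & e uv.1 uv.2]].

Definition separates (S : {set V}) (u v : V) := (u \in S) != (v \in S).

Lemma cut_setC S : #|cut (~: S)| = #|cut S|.
Proof.
have swapI : injective (fun uv : V * V => (uv.2, uv.1)) by move=> [? ?] [? ?] [-> ->].
rewrite -(card_imset _ swapI); apply: eq_card => -[u v].
apply/imsetP/idP => [[[u' v'] + [-> ->]]|].
  by rewrite !inE negbK /= e_sym => /and3P[-> ->].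
rewrite inE /= => /and3P[uS vS euv]; exists (v, u) => //.
by rewrite !inE /= vS uS e_sym.
Qed.

Lemma cut_submodular A B : #|cut (A :&: B)| + #|cut (A :|: B)| <= #|cut A| + #|cut B|.
Proof.
have E S : #|cut S| = \sum_(uv : V * V) (uv \in cut S).
  by rewrite -sum1_card big_mkcond.
rewrite !E -!big_split; apply: leq_sum => -[u v] _; rewrite !inE /=.
by case: (u \in A); case: (u \in B); case: (v \in A); case: (v \in B); case: (e u v).
Qed.

Lemma cut_posimodular A B : #|cut (A :\: B)| + #|cut (B :\: A)| <= #|cut A| + #|cut B|.
Proof.
have := cut_submodular A (~: B).
by rewrite -setDE -(cut_setC (A :|: _)) setCU setCK setIC -setDE cut_setC.
Qed.

Definition min_cut (S : {set V}) (a b : V) :=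
  separates S a b /\ forall X : {set V}, separates X a b -> #|cut S| <= #|cut X|.

Definition crosses (A B : {set V}) :=
  [&& A :&: B != set0, ~~ (A \subset B) & ~~ (B \subset A)].

Lemma separatesC S u v : separates S u v = separates S v u.
Proof. by rewrite /separates eq_sym. Qed.

Lemma separates_setC S u v : separates (~: S) u v = separates S u v.
Proof. by rewrite /separates !inE; case: (_ \in _); case: (_ \in _). Qed.


Lemma crossesP (A B : {set V}) :
  reflect (exists x y z, [/\ x \in A /\ x \in B, y \in A /\ y \notin B &
                             z \in B /\ z \notin A]) (crosses A B).
Proof.
apply: (iffP and3P) => [[/set0Pn[x] + /subsetPn[y] ? ? /subsetPn[z] ? ?]|].
  by rewrite inE => /andP[? ?]; exists x, y, z.
move=> [x [y [z [[xA xB] [yA yB] [zB zA]]]]]; split.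
- by apply/set0Pn; exists x; rewrite inE xA.
- by apply/subsetPn; exists y.
by apply/subsetPn; exists z.
Qed.

Lemma crossesC (A B : {set V}) : crosses A B = crosses B A.
Proof. by rewrite /crosses setIC; congr (_ && _); rewrite andbC. Qed.

Lemma not_crosses (A B : {set V}) : ~~ crosses A B ->
  [\/ forall x, x \in A -> x \notin B, A \subset B | B \subset A].
Proof.
rewrite !negb_and !negbK => /or3P[/eqP AB|?|?]; [|by constructor 2|by constructor 3].
constructor 1 => x xA; apply/negP => xB.
by have := in_set0 x; rewrite -AB inE xA xB.
Qed.

Lemma min_cutC S u v : min_cut S u v -> min_cut S v u.
Proof.
by case=> s m; split=> [|X]; rewrite separatesC //; apply: m.
Qed.

(* Each corner of [U] and [S] that separates [u] from [v] is opposite to a corner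
   that separates [a] from [b], so (posi)modularity makes it a minimum cut. *)
Lemma uncross (r : V) (S U : {set V}) (a b u v : V) :
  r \notin S -> r \notin U ->
  min_cut S a b -> min_cut U u v -> ~~ separates S u v -> crosses U S ->
  exists W : {set V}, [/\ min_cut W u v, r \notin W, ~~ crosses W S &
    forall Z, ~~ crosses Z S -> crosses W Z -> crosses U Z].
Proof.
move=> rS rU; wlog [aS bS] : a b / a \in S /\ b \notin S.
  move=> H mS; have sS := mS.1; move: (sS); rewrite /separates.
  case aS: (a \in S); case bS: (b \in S) => // _.
    by apply: (H a b) => //; rewrite aS bS.
  by apply: (H b a); rewrite ?bS ?aS //; apply: min_cutC.
move=> [_ minS] [sepU minU] nsep /crossesP[x [y [z [[xU xS] [yU yS] [zS zU]]]]].
(* The opposite corner [W'] costs at least as much as [S], so [W] costs at most as much as [U]. *)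
have minW (W W' : {set V}) : separates W u v -> separates W' a b ->
    #|cut W| + #|cut W'| <= #|cut U| + #|cut S| -> min_cut W u v.
  move=> sW sW' le; split=> // X /minU; apply: leq_trans.
  rewrite -(leq_add2r #|cut S|); apply: leq_trans le.
  by rewrite leq_add2l; apply: minS.
have subU := cut_submodular U S; have posU := cut_posimodular U S.
have posS := posU; rewrite addnC in posS; have subS := subU; rewrite addnC in subS.
move: sepU nsep; rewrite /separates negbK => sepU /eqP nsep.
(* If [S] contains [u] and [v], then [S :\: U] and [U :&: S] separate them; if it contains neither,
   [U :|: S] and [U :\: S] do. Whether [b], respectively [a], lies in [U] selects the one whose
   opposite corner separates [a] from [b]. *)
case vS : (v \in S) nsep => uS.
- case bU: (b \in U).
  + exists (S :\: U); split.
    * apply: minW posS; rewrite /separates !inE ?uS ?vS ?aS ?bS ?bU ?andbT ?andbF //.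
      by rewrite (inj_eq negb_inj).
    * by rewrite inE negb_and rS orbT.
    * by rewrite /crosses subsetDl !andbF.
    move=> Z /not_crosses ZS /crossesP[x' [y' [z' []]]].
    rewrite !inE !negb_and !negbK => -[/andP[x'U x'S] x'Z] [/andP[y'U y'S] y'Z] [z'Z z'W].
    case: ZS => [/(_ _ x'Z)|/subsetP ZS|/subsetP/(_ _ y'S)].
    * by rewrite x'S.
    * apply/crossesP; exists z', y, x'; split; split => //.
        by case/orP: z'W => //; rewrite ZS.
      by apply: contra yS; apply: ZS.
    * by rewrite (negPf y'Z).
  + exists (U :&: S); split.
    * apply: minW subU; rewrite /separates !inE ?uS ?vS ?aS ?bS ?bU ?andbT ?orbT //.
    * by rewrite inE negb_and rS orbT.
    * by rewrite /crosses subsetIr !andbF.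
    move=> Z /not_crosses ZS /crossesP[x' [y' [z' []]]].
    rewrite !inE !negb_and => -[/andP[x'U x'S] x'Z] [/andP[y'U y'S] y'Z] [z'Z z'W].
    case: ZS => [/(_ _ x'Z)|/subsetP ZS|/subsetP/(_ _ y'S)].
    * by rewrite x'S.
    * apply/crossesP; exists x', y, z'; split; split => //.
        by apply: contra yS; apply: ZS.
      by move: z'W; rewrite ZS // orbF.
    * by rewrite (negPf y'Z).
- case aU: (a \in U).
  + exists (U :|: S); split.
    * apply: minW subS; rewrite /separates !inE ?uS ?vS ?aS ?(negPf bS) ?aU ?andbF ?orbF //.
    * by rewrite inE negb_or rU.
    * by rewrite /crosses subsetUr !andbF.
    move=> Z /not_crosses ZS /crossesP[x' [y' [z' []]]].
    rewrite !inE !negb_or => -[x'W x'Z] [y'W y'Z] [z'Z /andP[z'U z'S]].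
    case: ZS => [ZS|/subsetP ZS|/subsetP ZS].
    * apply/crossesP; exists x', x, z'; split; split => //.
        by case/orP: x'W => // x'S; have := ZS _ x'Z; rewrite x'S.
      by apply: contraL xS; apply: ZS.
    * by rewrite ZS in z'S.
    * apply/crossesP; exists x, y', z'; split; split => //; first exact: ZS.
      by case/orP: y'W => // /ZS; rewrite (negPf y'Z).
  + exists (U :\: S); split.
    * apply: minW posU; rewrite /separates !inE ?uS ?vS ?aS ?(negPf bS) ?aU ?andbF ?orbF //.
    * by rewrite inE negb_and rU orbT.
    * rewrite /crosses (_ : _ :&: S = set0) ?eqxx //.
      by apply/setP => w; rewrite !inE; case: (w \in S); rewrite ?andbF.
    move=> Z /not_crosses ZS /crossesP[x' [y' [z' []]]].
    rewrite !inE !negb_and !negbK => -[/andP[x'S x'U] x'Z] [/andP[y'S y'U] y'Z] [z'Z z'W].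
    case: ZS => [ZS|/subsetP/(_ _ x'Z)|/subsetP ZS].
    * apply/crossesP; exists x', y', z'; split; split => //.
      by case/orP: z'W => // z'S; have := ZS _ z'Z; rewrite z'S.
    * by rewrite (negPf x'S).
    * apply/crossesP; exists x', y', z; split; split => //; exact: ZS.
Qed.

(** [L] is a largest laminar family of minimum cuts of size below [k]. If a pair with a small cut
    were not separated by [L], take a minimum cut for it crossing the fewest members: uncrossing
    shows that it crosses none, so it could be added. Excluding [r] fixes one side of each cut. *)
Lemma laminar_cuts (r : V) (k : nat) : exists L : {set {set V}},
  [/\ forall S, S \in L -> r \notin S /\ #|cut S| < k,
      forall A B, A \in L -> B \in L -> ~~ crosses A B &
      forall u v, (forall S, S \in L -> ~~ separates S u v) ->
        forall X, separates X u v -> k <= #|cut X|].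
Proof.
pose ok (L : {set {set V}}) :=
  (forall S, S \in L -> [/\ r \notin S, #|cut S| < k & exists a b, min_cut S a b]) /\
  (forall A B, A \in L -> B \in L -> ~~ crosses A B).
have ok0 : `[< ok set0 >] by apply/asboolP; split=> [S|A B]; rewrite inE.
have [L /asboolP[L1 L2] Lmax] :=
  @arg_maxnP _ set0 (fun L => `[< ok L >]) (fun L : {set {set V}} => #|L|) ok0.
exists L; split=> // [S /L1[] //|u v nsep X sX].
rewrite leqNgt; apply/negP => Xk.
have [U0 sU0 minU0] :=
  @arg_minnP _ X (fun Y => separates Y u v) (fun Y => #|cut Y|) sX.
pose P U := `[< min_cut U u v /\ r \notin U >].
have [U1 P1] : exists U1, P U1.
  case rU0 : (r \in U0); last by exists U0; apply/asboolP; rewrite rU0.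
  exists (~: U0); apply/asboolP; rewrite inE rU0; split=> //.
  by split=> [|Y]; rewrite ?separates_setC // cut_setC; apply: minU0.
have [U /asboolP[mU rU] Umin] :=
  @arg_minnP _ U1 P (fun U => #|[set S in L | crosses U S]|) P1.
have Uk : #|cut U| < k by apply: leq_ltn_trans Xk; apply: mU.2.
have [C0|[S]] := set_0Vmem [set S in L | crosses U S].
  have Unc S : S \in L -> ~~ crosses U S.
    by move=> SL; apply/negP => US; have := in_set0 S; rewrite -C0 inE SL US.
  have UL : U \notin L by apply: contraL mU.1 => /nsep.
  have /Lmax : `[< ok (U |: L) >].
    apply/asboolP; split=> [S|A B]; rewrite !inE.
      by move=> /predU1P[->|/L1//]; split=> //; exists u, v.
    move=> /predU1P[->|AL] /predU1P[->|BL]; [| |rewrite crossesC|]; auto.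
    by rewrite /crosses subxx !andbF.
  by rewrite cardsU1 UL; lia.
rewrite inE => /andP[SL US]; have [rS _ [a [b mS]]] := L1 _ SL.
have [W [mW rW WS WZ]] := uncross rS rU mS mU (nsep _ SL) US.
have := Umin W (introT (asboolP _) (conj mW rW)); rewrite leqNgt => /negP; apply.
apply: proper_card; apply/properP; split; last first.
  by exists S; rewrite !inE SL ?US // (negPf WS).
apply/subsetP => Z; rewrite !inE => /andP[ZL WZc]; rewrite ZL /=.
by apply: WZ => //; apply: L2.
Qed.
End Cuts.

(** * Flows and immersions *)

Section Flow.
Import Order.TTheory GRing.Theory Num.Theory.
Local Open Scope ring_scope.
Variable V : finType.
Implicit Types (e : rel V) (f : V -> V -> int).

(** Integral flow with unit capacities in antisymmetric form: negative values are flow in the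
    opposite direction, so the residual capacity of an arc is simply [e u v - f u v]. *)
Definition is_flow e f :=
  (forall u v, f u v = - f v u) /\ (forall u v, f u v <= (e u v)%:Z).

Definition net f v := \sum_w f v w.

Lemma net_cut f (S : {set V}) : (forall u v, f u v = - f v u) ->
  \sum_(v in S) net f v = \sum_(v in S) \sum_(w in ~: S) f v w.
Proof.
move=> skew.
have E v : net f v = \sum_(w in S) f v w + \sum_(w in ~: S) f v w.
  rewrite /net (bigID (mem S)) /=; congr (_ + _).
  by apply: eq_bigl => w; rewrite inE.
under eq_bigr => v _ do rewrite E.
rewrite big_split /=; set a := \sum_(v in S) _.
suff -> : a = 0 by rewrite add0r.
have : a = - a.
  rewrite {1}/a exchange_big /= -sumrN; apply: eq_bigr => v _.
  by rewrite -sumrN; apply: eq_bigr => w _; rewrite -skew.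
lia.
Qed.

Definition push f u v : V -> V -> int := fun x y =>
  f x y + ((x == u) && (y == v))%:Z - ((x == v) && (y == u))%:Z.

Lemma net_push f u v x : net (push f u v) x = net f x + (x == u)%:Z - (x == v)%:Z.
Proof.
have sum1 (b : bool) (z : V) : \sum_w (b && (w == z))%:Z = b%:Z.
  rewrite (bigD1 z) //= eqxx andbT big1 ?addr0 // => w /negPf ->.
  by rewrite andbF.
by rewrite /net /push sumrB big_split /= !sum1.
Qed.

Lemma push_skew f u v : (forall x y, f x y = - f y x) ->
  forall x y, push f u v x y = - push f u v y x.
Proof.
move=> skew x y; rewrite /push (skew x y) [(y == u) && _]andbC [(y == v) && _]andbC.
by lia.
Qed.

Lemma augment e f u p : is_flow e f ->
  path (fun x y => f x y < (e x y)%:Z) u p -> uniq (u :: p) ->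
  exists2 f', is_flow e f' &
    forall x, net f' x = net f x + (x == u)%:Z - (x == last u p)%:Z.
Proof.
elim: p u f => [|v p IH] u f [skew cap].
  by move=> _ _; exists f => // x; rewrite /=; lia.
move=> /= /andP[fuv pvp] /and3P[]; rewrite inE negb_or => /andP[uv up] vp unip.
have [|||f' ff' netf'] := IH v (push f u v).
- split=> [|x y]; first exact: push_skew.
  rewrite /push; case: (boolP ((x == u) && (y == v))) => [/andP[/eqP-> /eqP->]|_].
    by move: fuv; lia.
  by have := cap x y; lia.
- apply: (sub_in_path (P := [pred x | x != u]) _ _ pvp) => [x y xu yu /=|].
    by rewrite /push (negPf xu) (negPf yu) andbF /=; lia.
  by rewrite /= eq_sym uv; apply/allP => x xp /=; apply: contraNneq up => <-.
- by rewrite /= vp.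
exists f' => // x; rewrite netf' net_push; lia.
Qed.

(** An arc with positive flow carries exactly one unit. Cancelling it leaves the edge idle in both
    directions, so the edge can be deleted. *)
Lemma remove_path e f u p : symmetric e -> is_flow e f ->
  path (fun x y => 0 < f x y) u p -> uniq (u :: p) ->
  exists e' f', [/\ symmetric e', subrel e' e, is_flow e' f',
    forall x, net f' x = net f x - (x == u)%:Z + (x == last u p)%:Z &
    path (fun x y => e x y && ~~ e' x y) u p].
Proof.
elim: p u e f => [|v p IH] u e f e_sym [skew cap].
  by move=> _ _; exists e, f; split => // x; rewrite /=; lia.
move=> /= /andP[fuv pvp] /and3P[]; rewrite inE negb_or => /andP[uv up] vp unip.
pose e0 x y := e x y && ~~ ((x == u) && (y == v) || (x == v) && (y == u)).
have euv : e u v by have := cap u v; case: (e u v) => //=; lia.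
have e0_sym : symmetric e0.
  move=> x y; rewrite /e0 e_sym orbC; congr (_ && ~~ (_ || _)); exact: andbC.
have [|||e' [f' [e'_sym e'e0 ff' netf' pe']]] := IH v e0 (push f v u) e0_sym.
- split=> [|x y]; first exact: push_skew.
  have fuv1 := cap u v; rewrite euv in fuv1.
  rewrite /push /e0 [(x == v) && _]andbC.
  case: (boolP ((x == u) && (y == v))) => [/andP[/eqP-> /eqP->]|_].
    by rewrite (negPf uv); lia.
  case: (boolP ((y == u) && (x == v))) => [/andP[/eqP-> /eqP->]|_].
    by rewrite /= andbF skew; lia.
  by have := cap x y; rewrite andbT; lia.
- apply: (sub_in_path (P := [pred x | x != u]) _ _ pvp) => [x y xu yu /=|].
    by rewrite /push (negPf xu) (negPf yu) andbF /=; lia.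
  by rewrite /= eq_sym uv; apply/allP => x xp /=; apply: contraNneq up => <-.
- by rewrite /= vp.
exists e', f'; split => // [x y /e'e0/andP[]//|x|].
  by rewrite netf' net_push; lia.
rewrite euv /=; apply/andP; split.
  by apply/negP => /e'e0; rewrite /e0 !eqxx /= andbF.
by apply: sub_path pe' => x y /andP[/andP[-> _] ->].
Qed.

Lemma sum_count_mem (R : {set V}) (ds : seq V) :
  \sum_(v in R) (count_mem v ds)%:Z = (count (mem R) ds)%:Z.
Proof.
elim: ds => [|d ds IH] /=; first by rewrite big1.
under eq_bigr => v _ do rewrite PoszD.
rewrite big_split /= IH PoszD; congr (_ + _).
case dR: (d \in R) => /=.
  rewrite (bigD1 d) //= eqxx big1 ?addr0 // => v /andP[_ vd].
  by rewrite eq_sym (negPf vd).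
by rewrite big1 // => v vR; case: eqP => // dv; rewrite dv vR in dR.
Qed.

(** Max-flow min-cut for a list [ds] of unit demands, repetitions allowed, proved by augmenting
    paths. *)
Lemma max_flow e (s : V) (ds : seq V) : s \notin ds ->
  (forall d (X : {set V}), d \in ds -> s \in X -> d \notin X -> (size ds <= #|cut e X|)%N) ->
  exists2 f, is_flow e f & forall v, v != s -> net f v = - (count_mem v ds)%:Z.
Proof.
move=> sds cutP.
suff [f ff [fP fs]] : exists2 f, is_flow e f &
    (forall v, v != s -> - (count_mem v ds)%:Z <= net f v) /\ net f s = (size ds)%:Z.
  exists f => // v vs.
  (* Net flows sum to zero, so the lower bounds away from [s], whose total is minus the outflow of
     [s], are all attained. *)
  have sum0 : \sum_(x in [set: V]) net f x = 0.
    rewrite net_cut; last exact: ff.1.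
    by rewrite big1 // => x _; rewrite setCT big_set0.
  have := sum_count_mem setT ds.
  rewrite (@eq_count _ _ predT) ?count_predT => [sumds|x]; last by rewrite !inE.
  have : \sum_(x in [set: V]) (net f x + (count_mem x ds)%:Z) = (size ds)%:Z.
    by rewrite big_split /= sum0 add0r.
  rewrite (bigD1 s) ?inE //= fs (_ : count_mem s ds = 0%N); last exact/count_memPn.
  rewrite addr0 -[RHS]addr0 => /addrI H.
  suff : net f v + (count_mem v ds)%:Z = 0 by move/eqP; rewrite addr_eq0 => /eqP.
  apply: (psumr_eq0P _ H) => [x /andP[_ /fP]|]; first by rewrite -subr_ge0 opprK.
  by rewrite vs inE.
suff H n : (n <= size ds)%N -> exists2 f, is_flow e f &
    (forall v, v != s -> - (count_mem v ds)%:Z <= net f v <= 0) /\ net f s = n%:Z.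
  have [f ff [fP fs]] := H _ (leqnn _); exists f => //; split=> // v /fP; lia.
elim: n => [|n IH] nds.
  exists (fun _ _ => 0); first by split=> u v; lia.
  by split=> [v _|]; rewrite /net big1 //; lia.
have [f ff [fP fs]] := IH (ltnW nds).
pose res x y := f x y < (e x y)%:Z.
have [v /and3P[vs cv sv]|none] :=
    pickP (fun v => [&& v != s, - (count_mem v ds)%:Z < net f v & connect res s v]).
  have [p pp lp] := connectP sv; case/shortenP: pp lp => p' pp' up' _ vE.
  have [f' ff' netf'] := augment ff pp' up'; rewrite -vE in netf'.
  exists f' => //; split=> [x xs|].
    rewrite netf' (negPf xs); have := fP x xs.
    by case: eqP => [->|_]; lia.
  by rewrite netf' eqxx eq_sym (negPf vs) fs; lia.
(* Edges leaving [R] are saturated and demands inside [R] are met, so [#|cut e R|] is [n] minus the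
   number of demands in [R]. This is negative if [R] contains all demands, and otherwise below
   [size ds], against [cutP]. *)
pose R := [set x | connect res s x].
have sR : s \in R by rewrite inE connect0.
have sumR : \sum_(v in R) net f v = #|cut e R|%:Z.
  rewrite net_cut; last exact: ff.1.
  rewrite -sum1_card.
  rewrite (eq_bigl (fun uv : V * V => (uv.1 \in R) && ((uv.2 \in ~: R) && e uv.1 uv.2))).
    rewrite -(pair_big_dep (mem R) (fun u w => (w \in ~: R) && e u w) (fun _ _ => 1%N)) /=.
    rewrite (big_morph Posz PoszD (erefl _)); apply: eq_bigr => u uR.
    rewrite big_mkcondr /= (big_morph Posz PoszD (erefl _)); apply: eq_bigr => w wR.
    have := ff.2 u w.
    have : ~~ res u w.
      apply/negP => ruw; move: wR; rewrite !inE => /negP; apply.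
      by apply: connect_trans (connect1 ruw); rewrite inE in uR.
    by rewrite /res; case: (e u w); lia.
  by move=> [u w]; rewrite !inE.
have : \sum_(v in R) net f v = n%:Z - (count (mem R) ds)%:Z.
  rewrite -sum_count_mem (bigD1 s) //= [\sum_(v in R) _%:Z](bigD1 s) //=.
  have -> : count_mem s ds = 0%N by apply/count_memPn.
  rewrite fs add0r -sumrN; congr (_ + _); apply: eq_bigr => v /andP[vR vs].
  have := none v; rewrite vs; rewrite inE in vR; rewrite vR andbT /=.
  move=> /negbT; rewrite -leNgt => le1; case/andP: (fP v vs) => le2 _.
  by apply: le_anti; rewrite le1.
rewrite sumR; case: (boolP (all (mem R) ds)) => [aR|/allPn[d dds dR]].
  by rewrite (eqP (_ : count (mem R) ds == size ds)) -?all_count //; lia.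
by have := cutP d R dds sR dR; lia.
Qed.

(* The labelling [g] of the edges encodes pairwise edge-disjoint paths from [s],
   one to each entry of [ds]. *)
Lemma flow_decomposition e f (s : V) (ds : seq V) : symmetric e -> is_flow e f -> s \notin ds ->
  (forall v, v != s -> net f v = - (count_mem v ds)%:Z) ->
  exists2 g : V -> V -> nat, forall x y, g x y = g y x &
    forall i, (i < size ds)%N ->
      connect (fun x y => e x y && (g x y == i)) s (nth s ds i).
Proof.
elim: ds e f => [|d ds IH] e f e_sym ff; first by exists (fun _ _ => 0%N).
rewrite inE negb_or => /andP[sd sds] netf.
have sd' : connect (fun x y => 0 < f x y) s d.
  (* No positive flow enters [R], so its net outflow is nonnegative; if [s] were outside [R], the
     demand at [d] would make it negative. *)
  pose R := [set x | connect (fun x y => 0 < f x y) x d].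
  have dR : d \in R by rewrite inE connect0.
  apply: contrapT => /negP nsd.
  have : 0 <= \sum_(v in R) net f v.
    rewrite net_cut; last exact: ff.1.
    apply: sumr_ge0 => v; rewrite inE => vR; apply: sumr_ge0 => w; rewrite !inE => wR.
    rewrite ff.1; have : ~~ (0 < f w v); last by lia.
    by apply: contra wR => fwv; apply: connect_trans (connect1 fwv) vR.
  rewrite (bigD1 d) //= netf; last by rewrite eq_sym.
  have : \sum_(v in R | v != d) net f v <= 0.
    apply: sumr_le0 => v /andP[vR _]; rewrite netf; first by lia.
    by apply: contraNneq nsd => <-; rewrite inE in vR.
  by rewrite /= eqxx; move: (bigop _ _ _) (count _ _) => a b; lia.
have [p pp lp] := connectP sd'; case/shortenP: pp lp => p' pp' up' _ dE.
have [e' [f' [e'_sym e'e ff' netf' pe']]] := remove_path e_sym ff pp' up'.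
rewrite -dE in netf'.
have [|g g_sym gP] := IH e' f' e'_sym ff' sds.
  by move=> v vs; rewrite netf' netf // (negPf vs) /= [d == v]eq_sym; lia.
(* Label 0 covers the removed path to [d]; the remaining edges keep their recursive labels, shifted
   by one. *)
exists (fun x y => if e' x y then (g x y).+1 else 0%N) => [x y|[_|i]] /=.
- by rewrite e'_sym g_sym.
- rewrite dE; apply/connectP; exists p' => //.
  by apply: sub_path pe' => x y /andP[-> /negPf ->].
rewrite ltnS => /gP; apply: connect_sub => x y /andP[exy /eqP gi].
by apply: connect1; rewrite exy e'e // gi eqxx.
Qed.
End Flow.

(** * Immersions from edge connectivity *)

Lemma set2_eqP (T : finType) (a b c d : T) : [set a; b] = [set c; d] ->
  (a = c /\ b = d) \/ (a = d /\ b = c).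
Proof.
move=> E.
have: a \in [set c; d] by rewrite -E !inE eqxx.
have: b \in [set c; d] by rewrite -E !inE eqxx orbT.
have: c \in [set a; b] by rewrite E !inE eqxx.
have: d \in [set a; b] by rewrite E !inE eqxx orbT.
rewrite !inE => /orP[]/eqP ? /orP[]/eqP ? /orP[]/eqP ? /orP[]/eqP ?; subst; auto.
Qed.

Lemma path_edgesP (G : sgraph) (R : rel G) (p : seq G) (E : {set G}) :
  sorted R p -> E \in path_edges p -> exists x y, R x y /\ E = [set x; y].
Proof.
rewrite /path_edges; case: p => // x p /=.
elim: p x => //= y p IH x /andP[Rxy pp]; rewrite inE => /predU1P[->|]; last exact: IH.
by exists x, y.
Qed.

(** A hub [f h0] sends one unit of flow to [f i] for each ordered pair [(i, j)] with [i != h0]. The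
    edge [ij] of [H] is routed through the hub, along the paths labelled [(i, j)] and [(j, i)]. A
    label determines the unordered pair, so different edges get edge-disjoint paths. *)
Lemma immersion_of_edge_connected (G H : sgraph) (f : H -> G) : injective f ->
  (forall i j (X : {set G}), separates X (f i) (f j) ->
     #|H| ^ 2 <= #|cut (@adj G) X|) ->
  contains_immersion G H.
Proof.
move=> f_inj conn.
have [h0 _|noH] := pickP (mem [set: H]); last first.
  have H0 (v : H) : False by have := noH v; rewrite /= inE.
  exists f, (fun=> [::]); split=> // A B /imsetP[[v w]]; case: (H0 v).
pose ps := [seq (i, j) | i <- enum (predC1 h0), j <- enum H].
have mem_ps i j : ((i, j) \in ps) = (i != h0).
  apply/allpairsP/idP => [[[a b] [/= + _ [-> _]]]|ih0]; first by rewrite mem_enum.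
  by exists (i, j); split; rewrite //= mem_enum.
pose ds := [seq f ij.1 | ij <- ps].
have size_ds : size ds <= #|H| ^ 2.
  rewrite size_map size_allpairs -!cardE -mulnn leq_mul2r.
  by rewrite (max_card (predC1 h0)) orbT.
have sds : f h0 \notin ds.
  by apply/mapP => -[[i j] + /f_inj /= E]; rewrite mem_ps -E eqxx.
have [fl flow_fl net_fl] : exists2 fl, is_flow (@adj G) fl &
    forall v, v != f h0 -> net fl v = (- (count_mem v ds)%:Z)%R.
  apply: max_flow => // d X /mapP[[i j] _ ->] /= sX dX.
  by apply: leq_trans size_ds (conn h0 i _ _); rewrite /separates sX (negPf dX).
have [g g_sym gP] := flow_decomposition (@adj_sym G) flow_fl sds net_fl.
pose R (A : {set H}) := [rel x y : G | adj x y &&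
  [exists ij : H * H, [&& ij \in ps, A == [set ij.1; ij.2] & g x y == index ij ps]]].
have R_sym A : symmetric (R A) by move=> x y /=; rewrite adj_sym g_sym.
have hub i j : connect (R [set i; j]) (f h0) (f i).
  have [->|ih0] := eqVneq i h0; first exact: connect0.
  have ijps : (i, j) \in ps by rewrite mem_ps.
  have := gP (index (i, j) ps); rewrite size_map index_mem => /(_ ijps).
  rewrite (nth_map (i, j)) ?index_mem // nth_index //=.
  apply: connect_sub => x y /andP[axy gxy]; apply: connect1; rewrite /= axy.
  by apply/existsP; exists (i, j); rewrite ijps eqxx.
have /choice[P PP] : forall A : {set H}, exists p : seq G, forall v w : H, adj v w ->
    A = [set v; w] -> path_between (f v) (f w) p /\ sorted (R A) p.
  move=> A.
  have [[v w] /= /andP[vw /eqP AE]|none] :=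
      pickP (fun vw : H * H => adj vw.1 vw.2 && (A == [set vw.1; vw.2])); last first.
    by exists [::] => v w vw AE; have := none (v, w); rewrite /= vw AE eqxx.
  have : connect (R A) (f v) (f w).
    apply: connect_trans (_ : connect _ _ (f h0)) _; last by rewrite AE setUC; apply: hub.
    by rewrite (sym_connect_sym (R_sym A)) AE; apply: hub.
  case/connectP => p pp; case/shortenP: pp => p' pp' up' _ lp'.
  have isp : is_path (f v :: p').
    apply/and3P; split=> //; apply: sub_path pp' => x y /=; by case/andP.
  exists (f v :: p') => v' w' _; rewrite AE => /set2_eqP[] [<- <-].
    by split; [split; [|left]|rewrite -AE].
  by split; [split; [|right]|rewrite -AE].
exists f, P; split=> // [v w vw|A B].
  by have [] := PP _ v w vw erefl.
move=> /imsetP[[v w] + AE] /imsetP[[v' w'] + BE]; rewrite !inE /= => vw vw' AB.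
have [_ sA] := PP A v w vw AE; have [_ sB] := PP B v' w' vw' BE.
rewrite disjoint_has; apply/hasPn => E EA; apply/negP => EB.
have [x [y [/andP[_ /existsP[ij /and3P[ijps /eqP AE' /eqP gxy]]] Exy]]] := path_edgesP sA EA.
have [x' [y' [/andP[_ /existsP[ij' /and3P[ijps' /eqP BE' /eqP gxy']]] Exy']]] := path_edgesP sB EB.
have gE : g x y = g x' y'.
  by move: Exy'; rewrite Exy => /set2_eqP[] [-> ->].
have ijE : ij = ij' by rewrite -(nth_index ij ijps) -gxy gE gxy' nth_index.
by move/eqP: AB; rewrite AE' BE' ijE.
Qed.

(** * Colouring along a laminar family *)

Lemma nonrep_colourable_bounded_degree (V : finType) (e : rel V) (S : pred V) (D : nat) :
  symmetric e -> 0 < D -> (forall v, S v -> #|[set w | S w && e v w]| <= D) ->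
  nonrep_colourable e S (4 * D ^ 2 + 4 * D).
Proof.
move=> e_sym D0 degD; pose eS := [rel u v | [&& S u, S v & e u v]].
have [|v||psi psi_lt psi_nr] :=
    @bounded_degree_nonrep_colourable V eS D (4 * D ^ 2 + 4 * D).-1 _ D0.
- by move=> u v /=; rewrite e_sym andbCA.
- have [Sv|/negPf nSv] := boolP (S v).
    apply: leq_trans (degD v Sv); apply: subset_leq_card.
    by apply/subsetP => w; rewrite !inE => /and3P[_ -> ->].
  by rewrite (_ : [set w | eS v w] = set0) ?cards0 //; apply/setP => w; rewrite !inE /= nSv.
- by rewrite prednK //; lia.
exists psi => [v _|]; first by have := psi_lt v isT; rewrite prednK //; lia.
by apply: nonrep_on_sub psi_nr => // u v Su Sv /= ->; rewrite andbT; apply/andP.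
Qed.

(** Each vertex of [B] gets a private colour, which cannot occur in both halves of a repetition. *)
Lemma nonrep_colourable_few_exceptions (V : finType) (e : rel V) (S : pred V)
    (B : {set V}) (c : nat) :
  nonrep_colourable e [pred v | S v && (v \notin B)] c -> nonrep_colourable e S (#|B| + c).
Proof.
move=> [psi psi_lt psi_nr].
pose col v := if v \in B then index v (enum B) else #|B| + psi v.
have colB v : v \in B -> col v < #|B|.
  by move=> vB; rewrite /col vB cardE index_mem mem_enum.
have colB_inj v w : v \in B -> col v = col w -> v = w.
  move=> vB E; have := colB v vB; rewrite E {1}/col; case: ifP => [wB _|]; last by lia.
  move: E; rewrite /col vB wB => E.
  by rewrite -(nth_index v (s := enum B) (x := v)) ?mem_enum // E nth_index ?mem_enum.
exists col => [v Sv|q r qn uqr sqr aqr E].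
  rewrite /col; case: ifP => [vB|/negbT vB]; last by rewrite ltn_add2l psi_lt //= Sv.
  by have := colB v vB; rewrite /col vB; lia.
have nB v : v \in q ++ r -> v \notin B.
  have dis w : w \in q -> w \in r -> False.
    by move: uqr; rewrite cat_uniq => /and3P[_ /hasPn qr _] wq /qr; rewrite /= wq.
  move=> vqr; apply/negP => vB; move: vqr; rewrite mem_cat => /orP[vq|vr].
    have : col v \in map col r by rewrite -E map_f.
    by move=> /mapP[w wr /(colB_inj _ _ vB) vw]; apply: (dis v) => //; rewrite vw.
  have : col v \in map col q by rewrite E map_f.
  by move=> /mapP[w wq /(colB_inj _ _ vB) vw]; apply: (dis v) => //; rewrite vw.
apply: (psi_nr q r) => //.
  by apply/allP => v vqr; rewrite /= (allP aqr) // nB.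
have colE s : {subset s <= q ++ r} -> map col s = map (addn #|B|) (map psi s).
  by move=> sub; rewrite -map_comp; apply/eq_in_map => v /sub/nB/negPf vB; rewrite /col vB.
apply: (inj_map (@addnI #|B|)); rewrite -!colE // => v; by rewrite mem_cat => ->; rewrite ?orbT.
Qed.

Lemma colourable_of_nonrep_colourable (G : sgraph) (c k : nat) :
  c <= k -> nonrep_colourable (@adj G) predT c -> nonrepetitively_colourable G k.
Proof.
move=> ck [psi psi_lt psi_nr].
exists (fun v => Ordinal (leq_trans (psi_lt v isT) ck)) => p /and3P[pn up sp] [s szp rep].
apply: (psi_nr (take s p) (drop s p)); rewrite ?cat_take_drop //.
- by case: p s szp pn {up sp rep} => [//|x p] [|s] //=; lia.
- exact/allP.
have szt : size (take s p) = s by rewrite size_takel // szp; lia.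
have szd : size (drop s p) = s by rewrite size_drop szp; lia.
have x0 : G by case: (p) pn.
apply: (@eq_from_nth _ 0); rewrite !size_map ?szt ?szd // => i si.
rewrite !(nth_map x0) ?szt ?szd // nth_take // nth_drop.
exact: (congr1 val (rep x0 i si)).
Qed.

(** * Blocks of a laminar family of small cuts *)

Section LaminarColouring.
Variables (V : finType) (e : rel V) (L : {set {set V}}) (k t : nat).
Hypothesis e_sym : symmetric e.
Hypothesis e_irr : irreflexive e.
Hypothesis k_gt0 : 0 < k.
Hypothesis LT : setT \in L.
Hypothesis L_nc : forall A B, A \in L -> B \in L -> ~~ crosses A B.
Hypothesis L_cut : forall S, S \in L -> #|cut e S| < k.

(** For [S] in [L], these are the vertices for which [S] is the least member of [L] containing
    them. *)
Definition bag (S : {set V}) : {set V} :=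
  [set v in S | [forall Y in L, (v \in Y) ==> (S \subset Y)]].

Hypothesis bag_le : forall S, S \in L -> #|bag S| <= t.

Definition closed_nbhd v : {set V} := v |: [set w | e v w].

Lemma laminarP A B x : A \in L -> B \in L -> x \in A -> x \in B ->
  A \subset B \/ B \subset A.
Proof.
move=> AL BL xA xB; have := not_crosses (L_nc AL BL).
by case=> [/(_ x xA)|?|?]; [rewrite xB|left|right].
Qed.

(** Asking for the closed neighbourhood keeps all neighbours of [v] inside [home v]. By laminarity a
    member of least size is least by inclusion; [setT] ensures a candidate. *)
Definition home v : {set V} :=
  [arg min_(S < setT | (S \in L) && (closed_nbhd v \subset S)) #|S|].

Lemma homeP v : [/\ home v \in L, closed_nbhd v \subset home v &
  forall S, S \in L -> closed_nbhd v \subset S -> home v \subset S].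
Proof.
rewrite /home; case: arg_minnP => [|S /andP[SL NS] Smin]; first by rewrite LT subsetT.
split=> // Y YL NY.
have vN : v \in closed_nbhd v by rewrite !inE eqxx.
have [//|YS] := laminarP SL YL (subsetP NS _ vN) (subsetP NY _ vN).
have : Y == S by rewrite eqEcard YS Smin // YL.
by move=> /eqP->.
Qed.

Lemma mem_home v : v \in home v.
Proof. by have [_ /subsetP-> //] := homeP v; rewrite !inE eqxx. Qed.

Lemma adj_home u v : e v u -> u \in home v.
Proof. by have [_ /subsetP H _] := homeP v => evu; apply: H; rewrite !inE evu orbT. Qed.

Definition boundary (S : {set V}) : {set V} := [set v in S | ~~ (closed_nbhd v \subset S)].

Lemma boundary_cut (S : {set V}) : #|boundary S| <= #|cut e S|.
Proof.
apply: leq_trans (leq_imset_card (fun uv : V * V => uv.1) (cut e S)).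
apply: subset_leq_card; apply/subsetP => v.
rewrite inE => /andP[vS /subsetPn[w]]; rewrite !inE => /predU1P[->|evw wS].
  by rewrite vS.
by apply/imsetP; exists (v, w) => //; rewrite inE /= vS wS.
Qed.

Lemma boundary_home v (S : {set V}) : S \in L -> v \in boundary S -> S \subset home v.
Proof.
move=> SL; rewrite inE => /andP[vS nNS]; have [hL hN _] := homeP v.
have [hS|//] := laminarP hL SL (mem_home v) vS.
by move/negP: nNS; case; apply: subset_trans hN hS.
Qed.

Lemma boundary_of_home v (S : {set V}) :
  v \in S -> ~~ (home v \subset S) -> S \in L -> v \in boundary S.
Proof.
move=> vS hS SL; rewrite inE vS; apply: contra hS => NS.
by have [_ _] := homeP v; apply.
Qed.

(* Turning every boundary into a clique makes [home] satisfy the hypotheses of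
   [clique_blocks_nonrep_colourable]. *)
Definition filled : rel V := [rel u v | (u != v) &&
  (e u v || [exists S in L, (u \in boundary S) && (v \in boundary S)])].

Lemma filled_sym : symmetric filled.
Proof.
move=> u v; rewrite /filled /= eq_sym e_sym; congr (_ && (_ || _)).
by apply: eq_existsb => S; rewrite [(u \in _) && _]andbC.
Qed.

(** An injective numbering in which larger sets come first, so a set precedes its proper subsets. *)
Definition code (S : {set V}) : nat :=
  (#|V| - #|S|) * #|{set V}| + enum_rank S.

Lemma code_inj : injective code.
Proof.
move=> S S' E; apply: enum_rank_inj; apply: val_inj.
have := congr1 (modn^~ #|{set V}|) E.
by rewrite /code !modnMDl !modn_small.
Qed.

Lemma code_subset (S S' : {set V}) : S \subset S' -> code S' <= code S.
Proof.
rewrite subEproper => /predU1P[->//|/proper_card lt].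
have leV : #|S'| <= #|V| by apply: max_card.
have : (#|V| - #|S'|).+1 * #|{set V}| <= (#|V| - #|S|) * #|{set V}|.
  by rewrite leq_mul2r; apply/orP; right; exact: ltn_sub2l (leq_trans lt leV) lt.
rewrite mulSn /code addnC => le; apply: leq_trans (leq_addr _ _).
by apply: leq_trans le; rewrite leq_add2l ltnW.
Qed.

(** For an earlier neighbour [u], [home u] is not inside [home v], so it suffices that [u] lies in
    [home v]. It is adjacent to a vertex of the block, or shares with one the boundary of a member,
    and [boundary_home] applies. *)
Lemma backnbrs_boundary v : backnbrs (fun v => code (home v)) filled (code (home v))
  \subset boundary (home v).
Proof.
apply/subsetP => u; rewrite inE => /andP[lt /existsP[w /andP[/eqP/code_inj wv fuw]]].
rewrite -wv in lt *; have [hw _ _] := homeP w.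
have nsub : ~~ (home u \subset home w).
  by apply/negP => /code_subset; lia.
apply: boundary_of_home => //.
have /andP[_ /orP[euw|/existsP[S /and3P[SL uS wS]]]] := fuw.
  by apply: adj_home; rewrite e_sym.
by apply: (subsetP (boundary_home SL wS)); move: uS; rewrite inE => /andP[].
Qed.

Lemma filled_clique_blocks : clique_blocks (fun v => code (home v)) filled k.
Proof.
move=> z; have [v /eqP vz|none] := pickP (fun v => code (home v) == z).
  rewrite -vz; have [hv _ _] := homeP v; split.
    apply: leq_trans (subset_leq_card (backnbrs_boundary v)) _.
    by apply: leq_trans (boundary_cut _) (ltnW (L_cut hv)).
  move=> u w /(subsetP (backnbrs_boundary v)) ub /(subsetP (backnbrs_boundary v)) wb uw.
  by rewrite /filled /= uw; apply/orP; right; apply/existsP; exists (home v); rewrite hv ub wb.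
suff -> : backnbrs (fun v => code (home v)) filled z = set0.
  by rewrite cards0; split=> // u v; rewrite inE.
apply/setP => u; rewrite !inE; apply/negP => /andP[_ /existsP[v]].
by rewrite none.
Qed.

(** Outside the bag, [v] lies in a member not containing [S]; let [Y] be a largest one. Neighbours
    in the block that lie in [Y] are on its boundary. A filling edge at [v] comes from a member
    inside [Y], so neighbours outside [Y] use edges of the cut of [Y]. Each kind numbers at most
    [k]. *)
Lemma filled_degree (S : {set V}) v : S \in L -> home v = S -> v \notin bag S ->
  #|[set w | (home w == S) && filled v w]| <= 2 * k.
Proof.
move=> SL vS; have vinS : v \in S by rewrite -vS mem_home.
rewrite inE vinS /= => /forall_inPn[Y0 Y0L]; rewrite negb_imply => /andP[vY0 SY0].
pose P (Y : {set V}) := [&& Y \in L, v \in Y & ~~ (S \subset Y)].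
have P0 : P Y0 by rewrite /P Y0L vY0.
have [Y /and3P[YL vY SY] Ymax] := @arg_maxnP _ Y0 P (fun Y : {set V} => #|Y|) P0.
apply: (@leq_trans #|boundary Y :|: [set w | (w \notin Y) && e v w]|).
  apply: subset_leq_card; apply/subsetP => w; rewrite inE => /andP[/eqP wS fvw].
  have inY : w \in Y -> w \in boundary Y.
    by move=> wY; apply: boundary_of_home => //; rewrite wS.
  have /andP[_ /orP[evw|/existsP[Z /and3P[ZL vZ wZ]]]] := fvw.
    rewrite in_setU; have [/inY->//|wY] := boolP (w \in Y).
    by rewrite [w \in [set _ | _]]inE wY evw orbT.
  rewrite in_setU; apply/orP; left; apply: inY.
  move: wZ; rewrite inE => /andP[wZ _].
  have [vinZ nNZ] : v \in Z /\ ~~ (closed_nbhd v \subset Z) by move: vZ; rewrite inE => /andP[].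
  have SZ : ~~ (S \subset Z).
    apply: contra nNZ; rewrite -vS; apply: subset_trans; by have [] := homeP v.
  have PZ : P Z by rewrite /P ZL vinZ.
  have [/subsetP-> //|YZ] := laminarP ZL YL vinZ vY.
  have /eqP-> // : Y == Z by rewrite eqEcard YZ; apply: Ymax.
apply: leq_trans (leq_card_setU _ _) _.
have le1 : #|boundary Y| <= k by apply: leq_trans (boundary_cut _) (ltnW (L_cut YL)).
suff : #|[set w | (w \notin Y) && e v w]| <= k by lia.
apply: leq_trans (ltnW (L_cut YL)).
have pinj : injective (fun w : V => (v, w)) by move=> ? ? [].
rewrite -(card_imset _ pinj); apply: subset_leq_card.
by apply/subsetP => _ /imsetP[w + ->]; rewrite !inE vY.
Qed.

Lemma laminar_nonrep_colourable :
  nonrep_colourable e predT ((t + (4 * (2 * k) ^ 2 + 4 * (2 * k))) * 72 ^ k).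
Proof.
suff [psi psi_lt psi_nr] :
    nonrep_colourable filled predT ((t + (4 * (2 * k) ^ 2 + 4 * (2 * k))) * 72 ^ k).
  exists psi => //; apply: nonrep_on_sub psi_nr => // u v _ _ euv.
  by rewrite /filled /= euv andbT; apply: contraTneq euv => ->; rewrite e_irr.
apply: (clique_blocks_nonrep_colourable filled_sym filled_clique_blocks) => z.
have [v /eqP vz|none] := pickP (fun v => code (home v) == z); last first.
  exists (fun=> 0) => [v|[//|v q] r _ _ _ /andP[]]; by rewrite none.
have [SL _ _] := homeP v; set S := home v in SL vz.
have blockE w : (code (home w) == z) = (home w == S).
  by rewrite -vz (inj_eq code_inj).
have [|psi psi_lt psi_nr] := @nonrep_colourable_few_exceptions _ filled (fun w => home w == S)
    (bag S) (4 * (2 * k) ^ 2 + 4 * (2 * k)).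
  apply: nonrep_colourable_bounded_degree; [exact: filled_sym|lia|].
  move=> w /= /andP[/eqP wS wB]; apply: leq_trans (filled_degree SL wS wB).
  by apply: subset_leq_card; apply/subsetP => x; rewrite !inE => /andP[/andP[-> _] ->].
exists psi => [w|].
  by rewrite blockE => /psi_lt; have := bag_le SL; lia.
by apply: nonrep_on_sub psi_nr => // w; rewrite blockE.
Qed.
End LaminarColouring.

(** * Connectivity of bags and the final colour count *)

Lemma bag_edge_connected (V : finType) (e : rel V) (L : {set {set V}}) (S : {set V}) k :
  (forall u v, (forall S, S \in L -> ~~ separates S u v) ->
        forall X, separates X u v -> k <= #|cut e X|) ->
  {in bag L S &, forall u v X, separates X u v -> k <= #|cut e X|}.
Proof.
move=> L_sep u v; rewrite !inE => /andP[uS /forall_inP ub] /andP[vS /forall_inP vb].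
apply: L_sep => Y YL; rewrite /separates negbK.
have H x y : x \in S -> y \in S -> (forall Y, Y \in L -> (x \in Y) ==> (S \subset Y)) ->
    x \in Y -> y \in Y.
  by move=> xS yS xb xY; have /implyP/(_ xY)/subsetP := xb Y YL; apply.
by apply/eqP; apply/idP/idP; [apply: (H u v)|apply: (H v u)].
Qed.

Lemma colour_count_bound (t : nat) : 0 < t ->
  (t + (4 * (2 * t ^ 2) ^ 2 + 4 * (2 * t ^ 2))) * 72 ^ (t ^ 2) <= 4 ^ (9 * t ^ 2).
Proof.
move=> t0; have k0 : 0 < t ^ 2 by rewrite expn_gt0 t0.
have tk : t <= t ^ 2 by rewrite -mulnn leq_pmulr.
move: (t ^ 2) k0 tk => k k0 tk.
(* The exponent splits as 9 = 3 + 1 + 1 + 4: the first three parts bound the polynomial factor, the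
   last uses [72 <= 4 ^ 4]. *)
have -> : 4 ^ (9 * k) = (4 ^ 3) ^ k * 4 ^ k * 4 ^ k * (4 ^ 4) ^ k.
  by rewrite -!expnM -!expnD; congr (4 ^ _); lia.
apply: leq_mul; last by rewrite leq_exp2r.
have : k < 4 ^ k by rewrite ltn_expl.
have : 4 ^ 3 <= (4 ^ 3) ^ k by rewrite -{1}(expn1 (4 ^ 3)) leq_exp2l.
by move: ((4 ^ 3) ^ k) (4 ^ k) => a b; rewrite -!mulnn; nia.
Qed.

Theorem theorem3 :
  exists C : nat, 0 < C /\
    forall (t : nat) (H : sgraph), #|H| = t ->
    forall G : sgraph, ~ contains_immersion G H ->
      nonrepetitively_colourable G (4 ^ (t ^ 4 + C * t ^ 2)).
Proof.
exists 9; split=> // t H cardH G noH.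
have [r _|noG] := pickP (mem [set: G]); last first.
  have G0 (v : G) : False by have := noG v; rewrite /= inE.
  exists (fun v => match G0 v with end) => -[|v p] //; by case: (G0 v).
have [L [L1 L2 L3]] := laminar_cuts (@adj_sym G) r (t ^ 2).
(* The whole vertex set has an empty cut and gives every vertex a home. *)
pose L' := setT |: L.
have L'_nc A B : A \in L' -> B \in L' -> ~~ crosses A B.
  rewrite !in_setU1 => /predU1P[->|AL] /predU1P[->|BL]; last exact: L2.
  - by rewrite /crosses subsetT andbF.
  - by rewrite /crosses [B \subset _]subsetT !andbF.
  by rewrite /crosses [A \subset _]subsetT andbF.
have L'_sep u v : (forall S, S \in L' -> ~~ separates S u v) ->
    forall X, separates X u v -> t ^ 2 <= #|cut (@adj G) X|.
  by move=> H'; apply: L3 => S SL; apply: H'; rewrite in_setU1 SL orbT.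
have bag_lt S : #|bag L' S| < t.
  rewrite ltnNge; apply/negP => le; apply: noH.
  rewrite -cardH in le.
  (* [H] is placed on the first [t] vertices of a bag assumed too large. *)
  pose f (i : H) : G := enum_val (widen_ord le (enum_rank i)).
  apply: (@immersion_of_edge_connected G H f).
    move=> i j /enum_val_inj /(congr1 val) /= E.
    by apply: enum_rank_inj; apply: val_inj.
  move=> i j X; rewrite cardH; apply: (bag_edge_connected L'_sep);
    exact: enum_valP.
have t_gt0 : 0 < t by apply: leq_ltn_trans (bag_lt setT).
have k_gt0 : 0 < t ^ 2 by rewrite expn_gt0 t_gt0.
apply: colourable_of_nonrep_colourable
  (@laminar_nonrep_colourable _ _ L' _ t (@adj_sym G) (@adj_irr G) k_gt0 _ L'_nc _ _).
- apply: leq_trans (colour_count_bound t_gt0) _.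
  by rewrite leq_exp2l // leq_addl.
- by rewrite setU11.
- move=> S; rewrite in_setU1 => /predU1P[->|/L1[]//].
  rewrite (_ : cut _ _ = set0) ?cards0 //.
  by apply/setP => uv; rewrite !inE.
by move=> S _; apply: ltnW.
Qed.
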